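(* Let $\beta>1$ be irrational and let $\gamma=a\beta+c>1$, where $a,c\in\mathbb Q$ and $a+c\ne 1$. Set $b_-=\min\{\beta,\gamma\}$ and $b_+=\max\{\beta,\gamma\}$. If $b_+=b_-+1$ and $b_-\in\mathcal E$, then the set of Borel probability measures $\mu$ on $X$ with $(T_\beta)_*\mu=(T_\gamma)_*\mu=\mu$ is exactly $$\{(1-t)\delta_0+t\nu_{b_-}:0\le t\le 1\},$$ and $\nu_{b_-}=\nu_{b_+}$. In every other case, $\delta_0$ is the only Borel probability measure $\mu$ on $X$ with $(T_\beta)_*\mu=(T_\gamma)_*\mu=\mu$.
   Context: $X=[0,1)$, and $\lambda$ is Lebesgue probability measure on $X$. For a real number $b>1$, the beta-transformation $T_b:X\to X$ is $T_b(x)=bx-\lfloor bx\rfloor$. For a Borel map $F:X\to X$, $F_*\mu$ denotes the pushforward, $F_*\mu(E)=\mu(F^{-1}E)$. $\delta_0$ is the unit point mass at $0$. For each $b>1$, $\nu_b$ denotes the R\'enyi--Parry measure, i.e. the unique $T_b$-invariant Borel probability measure on $X$ that is absolutely continuous with respect to $\lambda$ (its existence and uniqueness are classical). With $\mathbb N=\{1,2,\ldots\}$, set $$\mathcal E=\{b>1: b^2-ub-v=0\text{ for some }u,v\in\mathbb N\text{ with }1\le v\le u\}.$$ *)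

(* Defs.v *)
From HB Require Import structures.
From mathcomp Require Import all_boot all_order all_algebra.
From mathcomp Require Import all_classical all_reals all_analysis.

Set Implicit Arguments.
Unset Strict Implicit.
Unset Printing Implicit Defensive.

Import Order.TTheory GRing.Theory Num.Theory.

Local Open Scope classical_set_scope.
Local Open Scope ring_scope.

Definition unit_interval (R : realType) : Type := {x : R | 0 <= x < 1}.

HB.instance Definition _ (R : realType) := Choice.on (unit_interval R).

Lemma zero_in_unit (R : realType) : 0 <= (0 : R) < 1.
Proof. by rewrite lexx ltr01. Qed.

Definition unit0 (R : realType) : unit_interval R := exist _ 0 (@zero_in_unit R).

HB.instance Definition _ (R : realType) :=
  isPointed.Build (unit_interval R) (unit0 R).

Definition unit_val (R : realType) (x : unit_interval R) : measurableTypeR R :=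
  sval x.

(* The Borel sets of the subspace [0,1) are the traces on it of the Borel sets
   of the line. *)
HB.instance Definition _ (R : realType) :=
  Measurable.copy (unit_interval R) (g_sigma_algebra_preimageType (@unit_val R)).

Section unit_lebesgue.
Variable R : realType.
Local Open Scope ereal_scope.

Definition unit_lebesgue (A : set (unit_interval R)) : \bar R :=
  @lebesgue_measure R (@unit_val R @` A).

Let unit_val_inj : injective (@unit_val R).
Proof. by move=> x y /val_inj. Qed.

Let measurable_image (A : set (unit_interval R)) :
  measurable A -> measurable (@unit_val R @` A).
Proof.
move=> [B mB]; rewrite setTI => <-.
rewrite (_ : _ @` _ = B `&` [set` `[0%R, 1%R[]).
  by apply: measurableI => //; exact: measurable_itv.
apply/seteqP; split=> [_ [x Bx <-]|x [Bx]] /=.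
  by split=> //=; rewrite in_itv/=; exact: (svalP x).
by rewrite in_itv/= => x01; exists (exist _ x x01).
Qed.

Let unit_lebesgue0 : unit_lebesgue set0 = 0.
Proof. by rewrite /unit_lebesgue image_set0 measure0. Qed.

Let unit_lebesgue_ge0 A : 0 <= unit_lebesgue A.
Proof. exact: measure_ge0. Qed.

Let unit_lebesgue_sigma_additive : semi_sigma_additive unit_lebesgue.
Proof.
move=> F mF tF mUF; rewrite /unit_lebesgue image_bigcup.
apply: measure_semi_sigma_additive.
- by move=> n; exact: measurable_image.
- move=> i j _ _ [_ [[x Fx <-] [y Fy /unit_val_inj yx]]].
  by apply: (tF i j) => //; exists x; split=> //; rewrite -yx.
- by rewrite -image_bigcup; exact: measurable_image.
Qed.

HB.instance Definition _ := isMeasure.Build _ (unit_interval R) R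
  unit_lebesgue unit_lebesgue0 unit_lebesgue_ge0 unit_lebesgue_sigma_additive.

Let unit_lebesgue_setT : unit_lebesgue setT = 1.
Proof.
rewrite /unit_lebesgue (_ : _ @` _ = [set` `[0%R, 1%R[]).
  by rewrite lebesgue_measure_itv/= lte_fin ltr01 oppr0 adde0.
apply/seteqP; split=> [_ [x _ <-]|x] /=; rewrite in_itv/=.
  exact: (svalP x).
by move=> x01; exists (exist _ x x01).
Qed.

HB.instance Definition _ :=
  Measure_isProbability.Build _ _ R unit_lebesgue unit_lebesgue_setT.

End unit_lebesgue.

Lemma beta_map_subproof (R : realType) (b : R) (x : unit_interval R) :
  0 <= b * unit_val x - (Num.floor (b * unit_val x))%:~R < 1.
Proof.
by rewrite subr_ge0 floor_le/= ltrBlDl -[X in _ + X]/(1%:~R) -intrD floorD1_gt.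
Qed.

Definition beta_map (R : realType) (b : R) (x : unit_interval R) :
  unit_interval R :=
  exist (fun y : R => 0 <= y < 1) _ (beta_map_subproof b x).

(* Library measures are functions on all subsets, so two measures on the same
   sigma-algebra are identified when they agree on the measurable sets. *)
Definition same_measure d (T : measurableType d) (R : realType)
  (mu nu : set T -> \bar R) : Prop := forall A, measurable A -> mu A = nu A.

Definition invariant_measure d (T : measurableType d) (R : realType)
  (F : T -> T) (mu : set T -> \bar R) : Prop :=
  same_measure (pushforward mu F) mu.

Definition is_renyi_parry (R : realType) (b : R)
  (nu : probability (unit_interval R) R) : Prop :=
  invariant_measure (beta_map b) nu /\ nu `<< @unit_lebesgue R.

(* For b > 1 a measure satisfying [is_renyi_parry b] exists and is unique in the
   sense of [same_measure]; the default value of [get] is never used there. *)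
Definition renyi_parry (R : realType) (b : R) :
  probability (unit_interval R) R := get (@is_renyi_parry R b).

Definition quadratic_parry (R : realType) : set R :=
  [set b | 1 < b /\ exists u v : nat,
     (1 <= v <= u)%N /\ b ^+ 2 - u%:R * b - v%:R = 0].

(* Main.v *)
(** Write [gamma = (p beta + q) / N] and let [mu] be invariant under both maps. The points
    [u = T_gamma (T_beta x)] and [v = T_beta (T_gamma x)] have the same law, and
    [N (u - v) = j beta] modulo [1] for an integer cocycle [j] of mean
    [(p + q - N) * int x dmu]. So [j] transports a law to itself along an irrational
    rotation; testing this against sawtooth sums shows that, when the mean of [j] is not
    [0], the translates of the law charge every interval at least proportionally to its
    length. Hence a singular [mu] has [int x dmu = 0], that is, it sits at [0].

    The absolutely continuous part of [mu] is then a multiple of both Parry measures. The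
    density of [nu_b] is proportional to [sum_n b^-n 1_(x < T_b^n 1)], and comparing the
    total weights and the jumps of this sum for two bases leaves only the case where [1]
    reaches [0] after two steps in the smaller base [b] while [T_(b+1) 1] is a fixed point
    in the larger base [b + 1]. *)

Require Import Defs.
From HB Require Import structures.
From mathcomp Require Import all_boot all_order all_algebra.
From mathcomp Require Import all_classical all_reals all_analysis.
From mathcomp Require Import measurable_realfun.
From mathcomp Require Import zify ring lra.

Set Implicit Arguments.
Unset Strict Implicit.
Unset Printing Implicit Defensive.

Import Order.TTheory GRing.Theory Num.Theory.
Import numFieldNormedType.Exports.

Local Open Scope classical_set_scope.
Local Open Scope ring_scope.

(** * The unit interval and finite measures *)

(** Since [renyi_parry] is chosen by [get], existence and uniqueness of the absolutely continuous
    invariant measure have to be proved here. Uniqueness is obtained without ergodic theory: the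
    positive and negative parts of a difference of two such measures are invariant and carried by
    disjoint sets, whereas the carrier of any nonzero one must contain a fixed interval at [0] up to
    a null set. Irrationality supplies multiples of [beta] just above an integer. Arcs of length
    [{n beta}] are exactly those whose visits along the rotation are controlled by a bounded
    function, and they are then short enough to subdivide the whole interval. The condition
    [a + c <> 1] says that the cocycle has nonzero mean as soon as [x] has. No Radon-Nikodym density
    is used. Proportional measures are compared through their mean densities on short intervals,
    with geometric error terms: the left limit at [1] fixes the constant, the right limit at [0]
    gives the total weights, and the two one-sided limits at any other point differ by the jump
    there. *)

Section FractionalPart.
Context {R : realType}.
Implicit Types (x y : R) (k : int).

Definition fractional_part x : R := x - (Num.floor x)%:~R.

Lemma fractional_part_itv x : 0 <= fractional_part x < 1.
Proof.
by rewrite subr_ge0 floor_le/= ltrBlDl -[X in _ + X]/(1%:~R) -intrD floorD1_gt.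
Qed.

Lemma fractional_part_ge0 x : 0 <= fractional_part x.
Proof. by case/andP: (fractional_part_itv x). Qed.

Lemma fractional_part_lt1 x : fractional_part x < 1.
Proof. by case/andP: (fractional_part_itv x). Qed.

Lemma floor_fractional_part x : x = (Num.floor x)%:~R + fractional_part x.
Proof. by rewrite /fractional_part addrC subrK. Qed.

Lemma fractional_part_eq k x : 0 <= x - k%:~R < 1 -> fractional_part x = x - k%:~R.
Proof.
move=> /andP[h0 h1]; rewrite /fractional_part; congr (_ - _%:~R).
by apply/floor_def; rewrite intrD -[1%:~R]/(1 : R); lra.
Qed.

Lemma fractional_part_id x : 0 <= x < 1 -> fractional_part x = x.
Proof. by move=> h; rewrite (@fractional_part_eq 0) subr0. Qed.

Lemma fractional_partDz x k : fractional_part (x + k%:~R) = fractional_part x.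
Proof.
rewrite (@fractional_part_eq (Num.floor x + k)) rmorphD/= opprD addrACA subrr addr0//.
exact: fractional_part_itv.
Qed.

Lemma fractional_part0 : fractional_part 0 = 0.
Proof. by rewrite fractional_part_id// lexx ltr01. Qed.

Lemma fractional_part_congr x y k : x = y + k%:~R -> fractional_part x = fractional_part y.
Proof. by move=> ->; rewrite fractional_partDz. Qed.

Lemma measurable_floorr : measurable_fun [set: R] (fun x => (Num.floor x)%:~R : R).
Proof.
apply: nondecreasing_measurable => // x y xy.
by rewrite ler_int le_floor.
Qed.

Lemma measurable_fractional_part : measurable_fun [set: R] fractional_part.
Proof. by apply: measurable_funB => //; exact: measurable_floorr. Qed.

End FractionalPart.

Section UnitInterval.
Context {R : realType}.
Local Notation X := (unit_interval R).
Implicit Types (A B : set X) (x y : X) (b : R).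

Lemma unit_val_ge0 x : 0 <= (unit_val x : R).
Proof. by case/andP: (svalP x). Qed.

Lemma unit_val_lt1 x : (unit_val x : R) < 1.
Proof. by case/andP: (svalP x). Qed.

Lemma unit_val_inj : injective (@unit_val R).
Proof. by move=> x y /val_inj. Qed.

Definition to_unit (r : R) : X := exist _ (fractional_part r) (fractional_part_itv r).

Lemma beta_mapE b x : beta_map b x = to_unit (b * unit_val x).
Proof. exact: unit_val_inj. Qed.

Lemma unit_val_beta_map b x : unit_val (beta_map b x) = fractional_part (b * unit_val x).
Proof. by []. Qed.

Lemma measurable_unit_val : measurable_fun [set: X] (@unit_val R : X -> measurableTypeR R).
Proof. by move=> _ B mB; exists B. Qed.

Lemma measurable_unit_val_preimage (B : set R) :
  measurable (B : set (measurableTypeR R)) -> measurable (@unit_val R @^-1` B).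
Proof. by move=> mB; exists B => //; rewrite setTI. Qed.

Lemma measurable_fun_to_unit d (Y : measurableType d) (f : Y -> R) :
  measurable_fun [set: Y] f -> measurable_fun [set: Y] (to_unit \o f).
Proof.
move=> mf _ _ [B mB <-]; rewrite !setTI.
have := measurableT_comp (@measurable_fractional_part R) mf.
by move=> /(_ measurableT B mB); rewrite setTI.
Qed.

Lemma measurable_beta_map b : measurable_fun [set: X] (@beta_map R b).
Proof.
have -> : @beta_map R b = to_unit \o (fun x : X => b * unit_val x).
  by apply/funext => x /=; rewrite beta_mapE.
apply: measurable_fun_to_unit; apply: measurable_funM => //.
exact: measurable_unit_val.
Qed.

Lemma measurable_preimage (F : X -> X) A : measurable_fun [set: X] F ->
  measurable A -> measurable (F @^-1` A).
Proof. by move=> mF mA; rewrite -[X in measurable X]setTI; exact: mF. Qed.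

Lemma measurable_fun_iter (F : X -> X) n : measurable_fun [set: X] F ->
  measurable_fun [set: X] (iter n F).
Proof.
move=> mF; elim: n => [|n IHn]; first exact: measurable_id.
exact: (measurableT_comp mF IHn).
Qed.

Lemma measurable_unit_image A : measurable A -> measurable (@unit_val R @` A).
Proof.
move=> [B mB]; rewrite setTI => <-.
rewrite (_ : _ @` _ = B `&` [set` `[0%R, 1%R[]).
  by apply: measurableI => //; exact: measurable_itv.
apply/seteqP; split=> [_ [x Bx <-]|x [Bx]] /=.
  by split=> //=; rewrite in_itv/= unit_val_ge0 unit_val_lt1.
by rewrite in_itv/= => x01; exists (exist _ x x01).
Qed.

Definition segment (l r : R) : set X := [set x | l <= (unit_val x : R) < r].

Lemma measurable_segment l r : measurable (segment l r).
Proof.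
rewrite (_ : segment l r = setT `&` @unit_val R @^-1` [set` `[l, r[]).
  by apply: measurable_unit_val => //; exact: measurable_itv.
by apply/seteqP; split=> x /=; rewrite in_itv//= => -[].
Qed.

End UnitInterval.

Section Mass.
Context d {T : measurableType d} {R : realType}.
Implicit Types (m : {finite_measure set T -> \bar R}) (A B : set T).

(** Real-valued, so that [lra] and ring arithmetic apply; by [massE] nothing is lost on measurable
    sets. *)
Definition mass m A : R := fine (m A).

Lemma massE m A : measurable A -> m A = (mass m A)%:E.
Proof. by move=> mA; rewrite fineK// fin_num_measure. Qed.

Lemma mass_ge0 m A : 0 <= mass m A.
Proof. by rewrite fine_ge0// measure_ge0. Qed.

Lemma mass_set0 m : mass m set0 = 0.
Proof. by rewrite /mass measure0. Qed.

Lemma massU m A B : measurable A -> measurable B -> A `&` B = set0 ->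
  mass m (A `|` B) = mass m A + mass m B.
Proof.
by move=> mA mB AB; rewrite /mass measureU// fineD// fin_num_measure.
Qed.

Lemma massID m A B : measurable A -> measurable B ->
  mass m A = mass m (A `&` B) + mass m (A `\` B).
Proof.
move=> mA mB; rewrite -massU; [|exact: measurableI|exact: measurableD|].
  by rewrite setUIDK.
by apply/seteqP; split=> // x [[_ ?] []].
Qed.

Lemma le_mass m A B : measurable A -> measurable B -> A `<=` B ->
  mass m A <= mass m B.
Proof.
by move=> mA mB AB; rewrite fine_le ?fin_num_measure// le_measure ?inE.
Qed.

Lemma mass_eq0 m A : measurable A -> mass m A = 0 -> m A = 0%E.
Proof. by move=> mA A0; rewrite massE// A0. Qed.

Lemma eq0_mass m A : m A = 0%E -> mass m A = 0.
Proof. by rewrite /mass => ->. Qed.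

Lemma massC m A : measurable A -> mass m (~` A) = mass m setT - mass m A.
Proof.
move=> mA; rewrite (@massID m setT A)// setTI setTD addrAC subrr add0r//.
Qed.

End Mass.

(** * The transfer identity for beta-transformations *)

Section FinitePushforward.
Context d d' {T : measurableType d} {T' : measurableType d'} {R : realType}.
Variables (m : {finite_measure set T -> \bar R}) (f : T -> T').
Hypothesis mf : measurable_fun [set: T] f.

(** The measurability proof is an argument of the constant, so that the measure instances below can
    be attached to it. *)
Definition finite_pushforward of measurable_fun [set: T] f := pushforward m f.

Local Notation push := (finite_pushforward mf).

Let push0 : push set0 = 0%E.
Proof. by rewrite /finite_pushforward /pushforward preimage_set0 measure0. Qed.

Let push_ge0 A : (0 <= push A)%E.
Proof. exact: measure_ge0. Qed.

Let push_sigma_additive : semi_sigma_additive push.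
Proof.
move=> F mF tF mUF; rewrite /finite_pushforward /pushforward preimage_bigcup.
apply: measure_semi_sigma_additive.
- by move=> n; rewrite -[X in measurable X]setTI; exact: mf.
- apply/trivIsetP => /= i j _ _ ij; rewrite -preimage_setI.
  by move/trivIsetP : tF => /(_ _ _ _ _ ij) ->//; rewrite preimage_set0.
- by rewrite -preimage_bigcup -[X in measurable X]setTI; exact: mf.
Qed.

HB.instance Definition _ := isMeasure.Build _ _ _ push
  push0 push_ge0 push_sigma_additive.

Let push_fin : fin_num_fun push.
Proof.
move=> A mA; rewrite /finite_pushforward /pushforward fin_num_measure//.
by rewrite -[X in measurable X]setTI; exact: mf.
Qed.

HB.instance Definition _ := @Measure_isFinite.Build _ _ _ push push_fin.

End FinitePushforward.

Section Lebesgue.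
Context {R : realType}.
Local Notation X := (unit_interval R).
Local Notation leb := (@lebesgue_measure R).
Local Notation lam := (@unit_lebesgue R).

(** By uniqueness of Lebesgue measure: [a] times the push-forward along the affine map gives every
    half-open interval its length. *)
Lemma lebesgue_affine (a c : R) (A : set R) : 0 < a ->
  measurable (A : set (measurableTypeR R)) ->
  leb ((fun x => a * x + c) @^-1` A) = ((a^-1)%:E * leb A)%E.
Proof.
move=> a0 mA.
pose f : measurableTypeR R -> measurableTypeR R := fun x => a * x + c.
have mf : measurable_fun [set: measurableTypeR R] f.
  by apply: measurable_funD => //; exact: measurable_funM.
pose p : {measure set (measurableTypeR R) -> \bar R} :=
  measure_function_pushforward__canonical__measure_function_Measure leb mf.
pose m : {measure set (measurableTypeR R) -> \bar R} := mscale (NngNum (ltW a0)) p.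
have -> : leb A = m A.
  apply: lebesgue_measure_unique => // _ [[x y]] _ <-.
  rewrite /m /= /mscale /= /pushforward.
  rewrite (_ : f @^-1` _ = [set` `](x - c) / a, (y - c) / a]]); last first.
    apply/seteqP; split=> z; rewrite /= !in_itv/= /f ltr_pdivrMr// ler_pdivlMr//.
      by move=> /andP[? ?]; apply/andP; split; lra.
    by move=> /andP[? ?]; apply/andP; split; lra.
  rewrite !lebesgue_measure_itv/= !lte_fin ltr_pdivrMr// divfK ?gt_eqF//.
  rewrite ltrD2r; case: ifPn => _; last by rewrite mule0.
  by rewrite -!EFinB -EFinM; congr EFin; field; rewrite gt_eqF.
by rewrite /m /= /mscale/= muleA -EFinM mulVf ?gt_eqF// mul1e.
Qed.

Lemma mass_segment (l r : R) : 0 <= l -> l <= r -> r <= 1 ->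
  mass lam (segment l r) = r - l.
Proof.
move=> l0 lr r1; rewrite /mass /= /unit_lebesgue.
rewrite (_ : _ @` _ = [set` `[l, r[]).
  rewrite lebesgue_measure_itv/= lte_fin; case: ltP => [_|rl]; first by rewrite -EFinB.
  by rewrite (le_anti (introT andP (conj lr rl))) subrr.
apply/seteqP; split=> [_ [x lxr <-]|x] /=; rewrite in_itv//= => /andP[lx xr].
have x01 : 0 <= x < 1 by rewrite (le_trans l0 lx) (lt_le_trans xr r1).
by exists (exist _ x x01) => //; rewrite /segment/= lx.
Qed.

Lemma mass_lam_setT : mass lam setT = 1.
Proof. by rewrite /mass /= probability_setT. Qed.

(** The last hypothesis keeps the affine preimage of [A] inside the unit interval, so that no part
    of it is cut off. *)
Lemma mass_affine (a c : R) (A : set X) (B : set X) : 0 < a ->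
  measurable A -> measurable B ->
  (forall x : X, B x <-> exists2 y : X, A y & (unit_val y : R) = a * unit_val x + c) ->
  (forall y : X, A y -> 0 <= ((unit_val y : R) - c) / a < 1) ->
  mass lam B = a^-1 * mass lam A.
Proof.
move=> a0 mA mB AB A01; rewrite /mass /=.
have -> : lam B = ((a^-1)%:E * lam A)%E.
  rewrite /unit_lebesgue -(@lebesgue_affine _ c)//; last exact: measurable_unit_image.
  congr leb; apply/seteqP; split=> [_ [x /AB[y Ay yE] <-]|r [y Ay yE]] /=.
    by exists y.
  have rE : r = ((unit_val y : R) - c) / a.
    by rewrite yE addrK mulrC mulKf ?gt_eqF.
  have r01 : 0 <= r < 1 by rewrite rE A01.
  exists (exist _ r r01) => //; apply/AB; exists y => //.
by rewrite fineM// fin_num_measure.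
Qed.

Lemma mass_branch (b w : R) (k : nat) (A : set X) : 0 < b -> 0 <= w -> w <= 1 ->
  (k%:R + w) / b <= 1 -> measurable A ->
  mass lam (segment (k%:R / b) ((k%:R + w) / b) `&` beta_map b @^-1` A) =
  b^-1 * mass lam (A `&` segment 0 w).
Proof.
move=> b0 w0 w1 kw1 mA; apply: (@mass_affine _ (- k%:R)) => //.
- by apply: measurableI => //; exact: measurable_segment.
- apply: measurableI; first exact: measurable_segment.
  by apply: measurable_preimage => //; exact: measurable_beta_map.
- move=> x; split=> [[/= /andP[]]|[y [Ay /andP[y0 yw]] yE]].
    rewrite ler_pdivrMr// ltr_pdivlMr// => xl xr TA.
    have fE : fractional_part (b * unit_val x) = b * unit_val x - k%:R.
      by rewrite (@fractional_part_eq _ k)//; apply/andP; split; lra.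
    exists (beta_map b x); last by rewrite unit_val_beta_map fE.
    by split=> //; apply/andP; rewrite unit_val_beta_map fE; split; lra.
  split.
    by rewrite /segment /= ler_pdivrMr// ltr_pdivlMr//; apply/andP; split; lra.
  rewrite /= (_ : beta_map b x = y)//; apply: unit_val_inj.
  rewrite unit_val_beta_map (@fractional_part_eq _ k) ?yE//.
  by rewrite -yE unit_val_ge0 unit_val_lt1.
- move=> y [_ /andP[y0 yw]]; rewrite opprK divr_ge0 ?addr_ge0 ?(ltW b0)//=.
  by apply: lt_le_trans kw1; rewrite ltr_pM2r ?invr_gt0//; lra.
Qed.

Lemma segment_split (l x r : R) : l <= x -> x <= r ->
  segment l r = segment l x `|` segment x r.
Proof.
move=> lx xr; apply/seteqP; split=> y; rewrite /segment/=.
  by move=> /andP[ly yr]; case: (ltP (unit_val y : R) x) => yx; [left|right]; apply/andP.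
by case=> /andP[? ?]; apply/andP; split; lra.
Qed.

Lemma segment_disjoint (l x r : R) : segment l x `&` segment x r = set0.
Proof.
by apply/seteqP; split=> // y [/andP[_ +] /andP[+ _]]; case: ltgtP.
Qed.

Lemma segment01 : segment 0 1 = [set: X].
Proof.
by apply/seteqP; split=> // x _; rewrite /segment/= unit_val_ge0 unit_val_lt1.
Qed.

Lemma mass_split (m : {finite_measure set X -> \bar R}) (l x r : R) (A : set X) :
  l <= x -> x <= r -> measurable A ->
  mass m (segment l r `&` A) = mass m (segment l x `&` A) + mass m (segment x r `&` A).
Proof.
move=> lx xr mA; rewrite (segment_split lx xr) setIUl massU//.
- by apply: measurableI => //; exact: measurable_segment.
- by apply: measurableI => //; exact: measurable_segment.
- by rewrite setIACA segment_disjoint set0I.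
Qed.

Lemma mass_full_branches (b : R) (k : nat) (A : set X) : 0 < b ->
  k%:R / b <= 1 -> measurable A ->
  mass lam (segment 0 (k%:R / b) `&` beta_map b @^-1` A) = k%:R / b * mass lam A.
Proof.
move=> b0 + mA; elim: k => [|k IHk] kb1.
  rewrite !mul0r (_ : segment 0 0 = set0) ?set0I ?mass_set0//.
  by apply/seteqP; split=> // x /andP[]; case: ltgtP.
have kb : k%:R / b <= k.+1%:R / b :> R by rewrite ler_pM2r ?invr_gt0// ler_nat.
rewrite (@mass_split _ _ (k%:R / b))//; first last.
- by apply: measurable_preimage => //; exact: measurable_beta_map.
- by rewrite divr_ge0 ?(ltW b0).
rewrite IHk ?(le_trans kb)// -[k.+1]addn1 natrD mass_branch//; last first.
  by rewrite -natrD addn1.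
by rewrite segment01 setIT mulrDl mulrDl mul1r.
Qed.

(** [[0, s)] consists of [floor (b s)] full branches of the map and one partial branch with image
    [[0, {b s})]. The remainder is again an initial segment, which allows the identity to be
    iterated. *)
Lemma mass_transfer (b s : R) (A : set X) : 0 < b -> 0 <= s -> s <= 1 -> measurable A ->
  mass lam (segment 0 s `&` beta_map b @^-1` A) =
  b^-1 * ((Num.floor (b * s))%:~R * mass lam A +
          mass lam (A `&` segment 0 (fractional_part (b * s)))).
Proof.
move=> b0 s0 s1 mA.
have /gez0_abs : 0 <= Num.floor (b * s) by rewrite floor_ge0 mulr_ge0// ltW.
set k := absz _ => kE; set w := fractional_part _.
have bsE : b * s = k%:R + w by rewrite [LHS]floor_fractional_part -kE.
have sE : s = (k%:R + w) / b by rewrite -bsE mulrC mulKf ?gt_eqF.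
have w0 : 0 <= w := fractional_part_ge0 _.
have w1 : w < 1 := fractional_part_lt1 _.
have ks : k%:R / b <= s by rewrite sE ler_pM2r ?invr_gt0// lerDl.
rewrite (@mass_split _ _ (k%:R / b))//; first last.
- by apply: measurable_preimage => //; exact: measurable_beta_map.
- by rewrite divr_ge0 ?(ltW b0).
rewrite mass_full_branches ?(le_trans ks)// {1}sE mass_branch ?(ltW w1)//; last first.
  by rewrite -sE.
by rewrite -kE -pmulrn mulrDr mulrA [b^-1 * k%:R]mulrC.
Qed.

End Lebesgue.

Section FiniteMeasures.
Context d {T : measurableType d} {R : realType}.
Implicit Types (m : {finite_measure set T -> \bar R}) (A B : set T).

(** The Jordan decomposition of [m1 - m2], phrased with masses so that charges do not appear
    later. *)
Lemma jordan_mass m1 m2 : exists P (p1 p2 : {finite_measure set T -> \bar R}),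
  measurable P /\ forall A, measurable A ->
    mass p1 A = mass m1 (A `&` P) - mass m2 (A `&` P) /\
    mass p2 A = mass m2 (A `\` P) - mass m1 (A `\` P).
Proof.
pose nu : {charge set T -> \bar R} :=
  cadd (charge_of_finite_measure m1) (cscale (-1) (charge_of_finite_measure m2)).
have nuE A : measurable A -> nu A = (mass m1 A - mass m2 A)%:E.
  move=> mA; rewrite (_ : nu A = m1 A + (-1)%:E * m2 A)%E//.
  by rewrite !massE// -EFinM mulN1r -EFinD.
have [P [N h]] := Hahn_decomposition nu.
have [[mP _] [mN _] PN PN0] := h.
have NE : N = ~` P.
  apply/seteqP; split=> [x Nx Px|x nPx].
    by have : (P `&` N) x by []; rewrite PN0.
  by have [] : (P `|` N) x by rewrite PN.
exists P, (jordan_pos h), (jordan_neg h); split=> // A mA; split.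
  rewrite {1}/mass /= jordan_posE cjordan_posE /crestr0 mem_set// /crestr.
  by rewrite nuE//; exact: measurableI.
rewrite {1}/mass /= jordan_negE cjordan_negE /crestr0 mem_set// /crestr.
by rewrite nuE ?NE -?setDE /= ?opprB//; exact: measurableD.
Qed.

Lemma finite_measure_lty m A : measurable A -> (m A < +oo)%E.
Proof. by move=> mA; rewrite massE// ltry. Qed.

Lemma lee_measure_mass m A (r : R) : measurable A -> r <= mass m A -> (r%:E <= m A)%E.
Proof. by move=> mA rA; rewrite massE// lee_fin. Qed.

(** The inequalities for a set and for its complement add up to an equality of total masses, so both
    are equalities. *)
Lemma mass_preimage_ge_eq m (F : T -> T) : measurable_fun [set: T] F ->
  (forall A, measurable A -> mass m A <= mass m (F @^-1` A)) ->
  forall A, measurable A -> mass m (F @^-1` A) = mass m A.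
Proof.
move=> mF mle A mA.
have mFA : measurable (F @^-1` A) by rewrite -[X in measurable X]setTI; exact: mF.
have := mle _ mA; have := mle _ (measurableC mA).
by rewrite preimage_setC !massC// => *; lra.
Qed.

Lemma measure_bigcup0 (m : {measure set T -> \bar R}) (F : nat -> set T) :
  (forall n, measurable (F n)) -> (forall n, m (F n) = 0%E) -> m (\bigcup_n F n) = 0%E.
Proof.
move=> mF F0; apply: measure_negligible; first exact: bigcupT_measurable.
by apply: negligible_bigcup => n; exists (F n); split.
Qed.

End FiniteMeasures.

(** * Fine subdivisions and domination of Lebesgue measure *)

Section Chains.
Context {R : realType}.
Local Notation X := (unit_interval R).
Local Notation lam := (@unit_lebesgue R).
Implicit Types (P Q : R -> R -> Prop) (l r x : R).

(** A finite subdivision of [[l, r)] into consecutive intervals satisfying [P]; as an inductive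
    relation it refines and concatenates by induction. *)
Inductive chain P : R -> R -> Prop :=
| chain_nil l : chain P l l
| chain_cons l x r : P l x -> chain P x r -> chain P l r.

Lemma chain_cat P l x r : chain P l x -> chain P x r -> chain P l r.
Proof. by elim=> // {}l y {}x Ply _ IH /IH; exact: chain_cons. Qed.

Lemma chain1 P l r : P l r -> chain P l r.
Proof. by move=> Plr; apply: (chain_cons Plr); exact: chain_nil. Qed.

Lemma chain_refine P Q l r : (forall l r, P l r -> chain Q l r) ->
  chain P l r -> chain Q l r.
Proof.
by move=> PQ; elim=> [{}l|{}l x {}r /PQ Qlx _]; [exact: chain_nil|exact: chain_cat].
Qed.

Lemma le_mass_segment l r : l <= r -> mass lam (segment l r) <= r - l.
Proof.
move=> lr.
have : (lam (segment l r) <= (r - l)%:E)%E.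
  rewrite -[(r - l)%:E](_ : lebesgue_measure ([set` `[l, r[] : set R) = _).
    apply: le_measure; rewrite ?inE.
    - by apply: measurable_unit_image; exact: measurable_segment.
    - exact: measurable_itv.
    - by move=> _ [x lxr <-] /=; rewrite in_itv.
  rewrite lebesgue_measure_itv/= lte_fin; case: ltP => // rl.
  by rewrite (le_anti (introT andP (conj lr rl))) subrr.
by rewrite massE ?lee_fin//; exact: measurable_segment.
Qed.

(** For a compact part of [A], with trace [K] on the unit interval, the intervals of a fine
    subdivision that meet [K] cover it and stay in a thin neighbourhood [U n]. Hence
    [c * lam K <= m (U n)], and the [U n] decrease to [K]. *)
Lemma lam_null_of_chains (m : {finite_measure set X -> \bar R}) (c : R) (A : set X) :
  0 < c -> measurable A ->
  (forall e, 0 < e -> chain (fun l r =>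
     [/\ l <= r, r - l <= e & c * (r - l) <= mass m (segment l r)]) 0 1) ->
  m A = 0%E -> lam A = 0%E.
Proof.
move=> c0 mA cm mA0; apply: mass_eq0 => //; apply/eqP; rewrite eq_le mass_ge0 andbT.
rewrite leNgt; apply/negP => A0.
have mA' : measurable (@unit_val R @` A) by exact: measurable_unit_image.
(* The tolerance is the mass of [A] itself, which leaves the compact part a positive mass. *)
have [V [cV VA AV]] : exists V : set R, [/\ compact V , V `<=` @unit_val R @` A &
    (lebesgue_measure ((@unit_val R @` A) `\` V) < (mass lam A)%:E)%E].
  apply: lebesgue_regularity_inner => //; rewrite [ltLHS](_ : _ = lam A)//.
  by rewrite massE// ltry.
pose K : set X := @unit_val R @^-1` V.
have clV : closed V by apply: compact_closed => //; exact: Rhausdorff.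
have mV : measurable (V : set (measurableTypeR R)) by exact: closed_measurable.
have mK : measurable K by exists V => //; rewrite setTI.
have KA : K `<=` A by move=> x /VA[y Ay /unit_val_inj <-].
have K0 : 0 < mass lam K.
  have : (lam (A `\` K) < (mass lam A)%:E)%E.
    apply: le_lt_trans AV; apply: le_measure; rewrite ?inE.
    - by apply: measurable_unit_image; exact: measurableD.
    - exact: measurableD.
    - by move=> _ [x [Ax Kx] <-]; split=> //; exists x.
  rewrite massE ?lte_fin; last exact: measurableD.
  rewrite [ltRHS](@massID _ _ _ lam A K)//.
  by rewrite (setIidr KA); lra.
pose U (n : nat) : set X := [set x | exists2 v, V v & `|v - unit_val x| < n.+1%:R^-1].
have mU n : measurable (U n).
  exists (\bigcup_(v in V) ball v n.+1%:R^-1).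
    by apply: open_measurable; apply: bigcup_open => v _; exact: ball_open.
  rewrite setTI; apply/seteqP; split=> x /=.
    by move=> [v Vv vx]; exists v.
  by move=> [v Vv vx]; exists v.
have capU : \bigcap_n U n = K.
  apply/seteqP; split=> [x Ux|x Kx n _]; last by exists (unit_val x); rewrite ?subrr ?normr0.
  apply: clV => B /nbhs_ballP[e /= e0 eB].
  have [n en] : exists n : nat, n.+1%:R^-1 < e.
    exists (Num.truncn e^-1); rewrite invf_plt ?posrE//.
    by have := truncnS_gt e^-1.
  have [v Vv vx] := Ux n I; exists v; split=> //; apply: eB => /=.
  by rewrite /ball/= distrC (lt_trans vx en).
have key n : c * mass lam K <= mass m (U n).
  (* A mesh strictly below the radius of [U n] puts every interval that meets [K] inside [U n]. *)
  have [/= n1 n2] : 0 < n.+1%:R^-1 / 2 :> R /\ n.+1%:R^-1 / 2 < n.+1%:R^-1 :> R.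
    by have : 0 < n.+1%:R^-1 :> R by []; move: n.+1%:R^-1 => q q0; split; lra.
  have : c * mass lam (segment 0 1 `&` K) <= mass m (segment 0 1 `&` U n).
    elim: (cm _ n1) => [l|l x r [lx xl cx] xr IH].
      rewrite (_ : segment l l = set0) ?set0I ?mass_set0 ?mulr0//.
      by apply/seteqP; split=> // x /andP[]; case: ltgtP.
    have {}xr : x <= r by elim: xr => // ? ? ? [? _ _] _; exact: le_trans.
    rewrite !(@mass_split _ _ l x r)// mulrDr lerD//.
    have [->|/set0P[y [yl Ky]]] := eqVneq (segment l x `&` K) set0.
      by rewrite mass_set0 mulr0 mass_ge0.
    rewrite (_ : segment l x `&` U n = segment l x); last first.
      apply/setIidPl => z /andP[lz zx]; exists (unit_val y) => //.
      move: yl xl n2 => /andP[ly yx]; move: n.+1%:R^-1 => q xl n2.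
      by rewrite ltr_norml; apply/andP; split; lra.
    apply: le_trans cx; rewrite ler_pM2l//; apply: le_trans (le_mass_segment lx).
    by apply: le_mass => //; [apply: measurableI => //|]; exact: measurable_segment.
  by rewrite segment01 !setTI.
have := @nonincreasing_cvg_mu _ _ _ m U; rewrite capU => cvgU.
have mU0 : m K = 0%E.
  by apply/eqP; rewrite eq_le measure_ge0 andbT -mA0 le_measure ?inE.
have {}cvgU : m \o U @ \oo --> m K.
  apply: cvgU => //; first exact: finite_measure_lty.
  move=> i j ij; apply/subsetPset => x [v Vv vx]; exists v => //.
  by apply: (lt_le_trans vx); rewrite lef_pV2 ?posrE// ler_nat.
have : ((c * mass lam K)%:E <= m K)%E.
  by apply: (cvge_to_ge cvgU); apply: nearW => n; exact: lee_measure_mass.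
by rewrite mU0 lee_fin leNgt mulr_gt0.
Qed.

End Chains.

(** * Uniqueness of the absolutely continuous invariant measure *)

Section Uniqueness.
Context {R : realType}.
Local Notation X := (unit_interval R).
Local Notation lam := (@unit_lebesgue R).
Variable b : R.
Hypothesis b1 : 1 < b.
Local Notation T := (@beta_map R b).

Let b0 : 0 < b. Proof. exact: lt_trans b1. Qed.

Let measurable_iter_preimage k (A : set X) : measurable A ->
  measurable (iter k T @^-1` A).
Proof.
by move=> mA; apply: measurable_preimage => //; apply: measurable_fun_iter;
  exact: measurable_beta_map.
Qed.

Definition near0 : R := (b - 1) / (2 * b).

(* Among bounds of the shape [(x s - y) * mass A], the transfer identity turns [(x, y)]
   into [(x - y, y / b)]; the value of [near0] keeps [x] above [1 / 2] forever. *)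
Lemma mass_iter_preimage_ge (A : set X) k (s : R) : measurable A -> A `<=` segment 0 near0 ->
  0 <= s -> s <= 1 ->
  ((1 + b ^- k) / 2 * s - near0 * b ^- k) * mass lam A <=
    mass lam (segment 0 s `&` iter k T @^-1` A).
Proof.
move=> mA Ae; have e0 : 0 < near0 by rewrite divr_gt0 ?mulr_gt0 ?subr_gt0.
have := mass_ge0 lam A; set al := mass _ A => al0.
elim: k s => [|k IHk] s s0 s1.
  rewrite expr0 invr1 -[X in X * s](_ : 1 = _); last by field.
  rewrite mul1r mulr1; have [es|se] := leP near0 s.
    rewrite (_ : _ `&` _ = A); last first.
      apply/setIidPr => x /Ae /andP[x0 xe]; apply/andP; split=> //.
      exact: lt_le_trans es.
    by rewrite -/al; nra.
  by apply: le_trans (mass_ge0 _ _); nra.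
rewrite (_ : iter k.+1 T @^-1` A = T @^-1` (iter k T @^-1` A)); last first.
  by apply/seteqP; split=> x /=; rewrite -iterS iterSr.
rewrite mass_transfer//; last exact: measurable_iter_preimage.
have bs0 : 0 <= b * s by rewrite mulr_ge0// ltW.
have := IHk 1 ler01 (lexx _); rewrite segment01 setTI.
have := IHk (fractional_part (b * s)) (fractional_part_ge0 _) (ltW (fractional_part_lt1 _)).
rewrite [X in mass _ X](setIC (segment 0 _)).
have := floor_fractional_part (b * s); have := floor_le (b * s).
have : 0 <= ((Num.floor (b * s))%:~R : R) by rewrite ler0z floor_ge0.
set K := _%:~R; set w := fractional_part _ => K0 Ks bsE.
set f1 := mass lam (iter _ _ @^-1` _); set fw := mass _ _ => fwle f1le.
rewrite -(ler_pM2l b0) [leRHS]mulrA mulfV ?gt_eqF// mul1r.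
have : 0 < b ^- k by rewrite invr_gt0 exprn_gt0.
move: fwle f1le; rewrite exprSr invfM; set q := b ^- k => fwle f1le q0.
have : K * (((1 + q) / 2 * 1 - near0 * q) * al) <= K * f1 by rewrite ler_wpM2l.
suff : b * (((1 + b^-1 * q) / 2 * s - near0 * (b^-1 * q)) * al) <=
    K * (((1 + q) / 2 * 1 - near0 * q) * al) + ((1 + q) / 2 * w - near0 * q) * al by lra.
have -> : K = b * s - w by lra.
have -> : b * (((1 + b^-1 * q) / 2 * s - near0 * (b^-1 * q)) * al) =
   ((b + q) / 2 * s - near0 * q) * al by field; rewrite gt_eqF.
rewrite !mulrA -mulrDl ler_wpM2r//.
have w0 : 0 <= w by exact: fractional_part_ge0.
have weq : 0 <= w * near0 * q by apply: mulr_ge0; [apply: mulr_ge0 => //; exact: ltW|exact: ltW].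
(* This is where the value of [near0] enters: the terms in [s] cancel and the two sides differ
   exactly by the quantity in [weq]. *)
have sqe : s * q * (near0 * (2 * b)) = s * q * (b - 1).
  by rewrite /near0 divfK// gt_eqF// mulr_gt0.
lra.
Qed.
(** The interval [[l, l + s / b^n)] lies in one branch of the [n]-th iterate, which maps it affinely
    onto [[0, s)]. *)
Definition affine_piece (n : nat) (l s : R) : Prop :=
  [/\ 0 <= l, 0 <= s <= 1, l + s / b ^+ n <= 1 & forall x : X,
    l <= (unit_val x : R) < l + s / b ^+ n ->
    (unit_val (iter n T x) : R) = b ^+ n * (unit_val x - l)].

(** The level is only bounded below, which is stable under refinement and still bounds the length by
    [b ^- n]. *)
Definition affine_piece_itv (n : nat) (l r : R) : Prop :=
  exists m s, [/\ (n <= m)%N, affine_piece m l s & r = l + s / b ^+ m].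

Lemma affine_piece0 : affine_piece 0 0 1.
Proof.
split; rewrite ?ler01 ?lexx//; first by rewrite expr0 divr1 add0r.
by move=> x _; rewrite expr0 mul1r subr0.
Qed.

Lemma affine_piece_sub n l s k w : affine_piece n l s -> 0 <= w -> w <= 1 ->
  k%:R + w <= b * s -> affine_piece n.+1 (l + k%:R / b ^+ n.+1) w.
Proof.
move=> [l0 /andP[s0 s1] ls1 lsE] w0 w1 kws.
have bn0 : 0 < b ^+ n by rewrite exprn_gt0.
have bn10 : 0 < b ^+ n.+1 by rewrite exprn_gt0.
have kE : k%:R / b ^+ n.+1 * b ^+ n.+1 = k%:R :> R by rewrite divfK// gt_eqF.
have wE : w / b ^+ n.+1 * b ^+ n.+1 = w by rewrite divfK// gt_eqF.
have le_s : k%:R / b ^+ n.+1 + w / b ^+ n.+1 <= s / b ^+ n.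
  rewrite -(ler_pM2r bn10) mulrDl kE wE exprS mulrCA divfK ?gt_eqF//.
have k0 : 0 <= k%:R / b ^+ n.+1 by rewrite divr_ge0// ltW.
have w0' : 0 <= w / b ^+ n.+1 by rewrite divr_ge0// ltW.
split; [exact: addr_ge0|by rewrite w0|by rewrite -addrA (le_trans _ ls1)// lerD2l|].
move=> x /andP[xl xr].
have /lsE xE : l <= (unit_val x : R) < l + s / b ^+ n.
  by apply/andP; split; [apply: le_trans xl; rewrite lerDl|
    apply: lt_le_trans xr _; rewrite -addrA lerD2l].
rewrite iterS unit_val_beta_map xE mulrA -exprS.
have zE : b ^+ n.+1 * (unit_val x - l) - k%:R =
    b ^+ n.+1 * (unit_val x - (l + k%:R / b ^+ n.+1)).
  by rewrite opprD addrA [RHS]mulrDr mulrN [b ^+ n.+1 * (_ / _)]mulrC kE.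
rewrite (@fractional_part_eq _ k) -?zE// zE; apply/andP; split.
  by rewrite mulr_ge0 ?subr_ge0// ltW.
rewrite (lt_le_trans _ w1)// -[ltRHS]wE [ltRHS]mulrC ltr_pM2l//.
by rewrite ltrBlDl.
Qed.

(** The image [[0, s)] splits as in [mass_transfer], into [floor (b s)] full pieces and one with
    image [[0, {b s})]. *)
Lemma affine_piece_chain n l s : affine_piece n l s ->
  chain (affine_piece_itv n.+1) l (l + s / b ^+ n).
Proof.
move=> ap; have [_ /andP[s0 s1] _ _] := ap.
have bn10 : 0 < b ^+ n.+1 by rewrite exprn_gt0.
have /gez0_abs : 0 <= Num.floor (b * s) by rewrite floor_ge0 mulr_ge0// ltW.
set k := absz _ => kE; have := floor_fractional_part (b * s).
have := fractional_part_ge0 (b * s); have := fractional_part_lt1 (b * s).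
rewrite -kE -pmulrn; set w := fractional_part _ => w1 w0 bsE.
have full j : (j <= k)%N -> chain (affine_piece_itv n.+1) l (l + j%:R / b ^+ n.+1).
  elim: j => [|j IHj] jk; first by rewrite mul0r addr0; exact: chain_nil.
  apply: chain_cat (IHj (ltnW jk)) _; apply: chain1; exists n.+1, 1; split=> //.
    apply: (affine_piece_sub ap) => //.
    have : (j.+1%:R <= k%:R :> R) by rewrite ler_nat.
    by rewrite -natr1 => ?; lra.
  by rewrite -addrA -mulrDl natr1.
apply: chain_cat (full _ (leqnn _)) _; apply: chain1; exists n.+1, w; split=> //.
  by apply: (affine_piece_sub ap) => //; [exact: ltW|rewrite bsE].
by rewrite -addrA -mulrDl -bsE exprS invfM mulrACA mulfV ?gt_eqF// mul1r.
Qed.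

Lemma affine_piece_refine m n l s : affine_piece n l s ->
  chain (affine_piece_itv (n + m)) l (l + s / b ^+ n).
Proof.
elim: m => [|m IHm] ap; first by apply: chain1; exists n, s; rewrite addn0.
rewrite addnS; apply: chain_refine (IHm ap) => x y [i [t [ni /affine_piece_chain + ->]]].
apply: chain_refine => {}x {}y [j [u [ij ? ->]]]; apply: chain1.
by exists j, u; split=> //; apply: leq_trans ij.
Qed.

Lemma expr_inv_lt (e : R) : 0 < e -> exists n, b ^- n < e.
Proof.
move=> e0; have : `|b^-1| < 1 by rewrite gtr0_norm ?invr_gt0// invf_lt1.
move=> /cvg_expr /cvgrPdist_lt /(_ e e0)[N _ /(_ N (leqnn N))] /=.
rewrite sub0r normrN exprVn ger0_norm ?invr_ge0 ?exprn_ge0 ?ltW// => h.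
by exists N.
Qed.

Lemma mass_affine_piece_preimage n l s (A : set X) : affine_piece n l s -> measurable A ->
  mass lam (segment l (l + s / b ^+ n) `&` iter n T @^-1` A) =
    b ^- n * mass lam (segment 0 s `&` A).
Proof.
move=> [l0 /andP[s0 s1] ls1 lsE] mA; have bn0 : 0 < b ^+ n by rewrite exprn_gt0.
apply: (@mass_affine _ _ (- (b ^+ n * l))) => //.
- by apply: measurableI => //; exact: measurable_segment.
- by apply: measurableI; [exact: measurable_segment|exact: measurable_iter_preimage].
- move=> x; rewrite -mulrBr; split=> [[lx Ax]|[y [/andP[y0 ys] Ay] yE]].
    exists (iter n T x); last exact: lsE.
    split=> //; apply/andP; rewrite lsE//; move: lx => /andP[lx xl].
    by rewrite mulr_ge0 ?subr_ge0 ?(ltW bn0)//= mulrC -ltr_pdivlMr// ltrBlDl.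
  have lx : segment l (l + s / b ^+ n) x.
    apply/andP; rewrite -ltrBlDl ltr_pdivlMr// mulrC -yE; split=> //.
    by rewrite -subr_ge0 -(pmulr_rge0 _ bn0) -yE.
  by split=> //=; rewrite (_ : iter n T x = y)//; apply: unit_val_inj; rewrite lsE.
- move=> y [/andP[y0 ys] _]; rewrite opprK; apply/andP; split.
    by rewrite divr_ge0 ?addr_ge0 ?mulr_ge0// ltW.
  rewrite mulrDl [b ^+ n * l]mulrC mulfK ?gt_eqF// addrC (lt_le_trans _ ls1)//.
  by rewrite ltrD2l ltr_pM2r ?invr_gt0.
Qed.

(* If [A] is the part of [[0, near0)] missed by [S], then for large [k] the points of an
   affine piece [I] of level [n] that [T^(n+k)] sends into [A] have mass close to
   [|I| * lam A / 2], by [mass_iter_preimage_ge]; no such piece can be almost filled by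
   points whose whole orbit stays in [S]. *)
Lemma invariant_contains_near0 (m : {finite_measure set X -> \bar R}) (S : set X) :
  (forall A, measurable A -> mass m (T @^-1` A) = mass m A) ->
  (forall A, measurable A -> lam A = 0%E -> m A = 0%E) ->
  0 < mass m setT -> measurable S -> mass m (~` S) = 0 ->
  mass lam (segment 0 near0 `\` S) = 0.
Proof.
move=> mT mac m0 mS mS0; set A := _ `\` S.
have mA : measurable A by apply: measurableD => //; exact: measurable_segment.
apply/eqP; rewrite eq_le mass_ge0 andbT leNgt; apply/negP => A0.
(* The points whose whole orbit stays in [S]; by invariance their complement is [m]-null. *)
pose S' := ~` \bigcup_n (iter n T @^-1` (~` S)).
have mSn n : measurable (iter n T @^-1` (~` S)).
  by apply: measurable_iter_preimage; exact: measurableC.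
have mS' : measurable S' by apply: measurableC; exact: bigcupT_measurable.
have S'0 : m (~` S') = 0%E.
  rewrite setCK; apply: measure_bigcup0 => // n; apply: mass_eq0 => //.
  elim: n => [//|n IHn]; rewrite -[RHS]IHn -[RHS]mT//; congr (mass m _).
  by apply/seteqP; split=> x /=; rewrite -iterS iterSr.
suff : lam S' = 0%E.
  move=> /(mac _ mS') S'0'; move: m0; rewrite (@massID _ _ _ m setT S')//.
  by rewrite setTI setTD /mass S'0 S'0' addr0 ltxx.
(* [S'] is [k]-null by construction, so [lam_null_of_chains] reduces its [lam]-nullity to lower
   bounds for [k] on affine pieces. *)
pose k : {finite_measure set X -> \bar R} := mrestr lam (measurableC mS').
have kE B : mass k B = mass lam (B `&` ~` S') by [].
have e0 : 0 < near0 by rewrite divr_gt0 ?mulr_gt0 ?subr_gt0.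
apply: (@lam_null_of_chains _ k (mass lam A / 2)) => //; first by rewrite divr_gt0.
  move=> e /expr_inv_lt[N Ne].
  have := affine_piece_refine N affine_piece0.
  rewrite !add0n expr0 divr1 add0r; apply: chain_refine => l r [n [s [Nn ap ->]]].
  apply: chain1; have [_ /andP[s0 s1] _ _] := ap.
  have bn0 : 0 < b ^- n by rewrite invr_gt0 exprn_gt0.
  split.
  - by rewrite lerDl mulr_ge0// ltW.
  - rewrite addrAC subrr add0r (le_trans _ (ltW Ne))//.
    rewrite (@le_trans _ _ (b ^- n))//; first by rewrite ler_piMl// ltW.
    by rewrite lef_pV2 ?posrE ?exprn_gt0// ler_weXn2l// ltW.
  - rewrite addrAC subrr add0r kE; set f := mass lam (_ `&` ~` S').
    have lef j : b ^- n * mass lam (segment 0 s `&` iter j T @^-1` A) <= f.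
      rewrite -(mass_affine_piece_preimage ap); last exact: measurable_iter_preimage.
      apply: le_mass.
      + apply: measurableI; first exact: measurable_segment.
        by do 2 apply: measurable_iter_preimage.
      + by apply: measurableI; [exact: measurable_segment|exact: measurableC].
      + move=> x [lx jx]; split; [exact: lx|rewrite /S' setCK].
        by exists (j + n)%N => //; rewrite /= iterD; case: jx.
    rewrite leNgt; apply/negP => fs.
    (* This [j] makes the error term of [mass_iter_preimage_ge], scaled to the piece, smaller than
       the supposed deficit. *)
    have [j jf] : exists j, b ^- j < (mass lam A / 2 * (s / b ^+ n) - f) /
        (near0 * mass lam A * b ^- n).
      by apply: expr_inv_lt; apply: divr_gt0; [rewrite subr_gt0|do 2 apply: mulr_gt0 => //].
    have := mass_iter_preimage_ge j mA (@subDsetl _ _ _) s0 s1.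
    rewrite -(ler_pM2l bn0) => /le_trans /(_ (lef j)).
    move: jf; rewrite ltr_pdivlMr; last by do 2 apply: mulr_gt0 => //.
    have : 0 < b ^- j by rewrite invr_gt0 exprn_gt0.
    have : 0 <= s * mass lam A * b ^- n * b ^- j.
      by rewrite !mulr_ge0 ?invr_ge0 ?exprn_ge0 ?(ltW A0) ?(ltW b0).
    by move: (b ^- j) (b ^- n) => q p; lra.
by rewrite /k /= /mrestr setICr measure0.
Qed.

(** The two parts [p1], [p2] of [m1 - m2] are invariant, have equal total mass and live on [P] and
    on its complement. If that mass were positive, [P] and its complement would both contain almost
    all of [[0, near0)]. *)
Theorem invariant_ac_unique (m1 m2 : {finite_measure set X -> \bar R}) :
  (forall A, measurable A -> mass m1 (T @^-1` A) = mass m1 A) ->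
  (forall A, measurable A -> mass m2 (T @^-1` A) = mass m2 A) ->
  (forall A, measurable A -> lam A = 0%E -> m1 A = 0%E) ->
  (forall A, measurable A -> lam A = 0%E -> m2 A = 0%E) ->
  mass m1 setT = mass m2 setT ->
  forall A, measurable A -> m1 A = m2 A.
Proof.
move=> m1T m2T m1ac m2ac m12.
have mT B : measurable B -> measurable (T @^-1` B).
  by move=> mB; apply: measurable_preimage => //; exact: measurable_beta_map.
have [P [p1 [p2 [mP pE]]]] := jordan_mass m1 m2.
have mI B : measurable B -> measurable (B `&` P) by move=> ?; exact: measurableI.
have mD B : measurable B -> measurable (B `\` P) by move=> ?; exact: measurableD.
have p1T : forall B, measurable B -> mass p1 (T @^-1` B) = mass p1 B.
  apply: mass_preimage_ge_eq => [|B mB]; first exact: measurable_beta_map.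
  (* By invariance this is the value of [m1 - m2], that is [p1 - p2], on the preimage of the
     positive part of [B]; dropping [p2] only increases it. *)
  have -> : mass p1 B = mass m1 (T @^-1` (B `&` P)) - mass m2 (T @^-1` (B `&` P)).
    by rewrite m1T ?m2T; [rewrite (pE _ mB).1|exact: mI|exact: mI].
  have mC := mT _ (mI _ mB).
  have := mass_ge0 p2 (T @^-1` (B `&` P)); rewrite (pE _ mC).2.
  have : mass p1 (T @^-1` (B `&` P)) <= mass p1 (T @^-1` B).
    by apply: le_mass => //; [exact: mT|move=> x []].
  by rewrite (pE _ mC).1 (@massID _ _ _ m1 _ P mC)// (@massID _ _ _ m2 _ P mC)//; lra.
have p2T : forall B, measurable B -> mass p2 (T @^-1` B) = mass p2 B.
  apply: mass_preimage_ge_eq => [|B mB]; first exact: measurable_beta_map.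
  have -> : mass p2 B = mass m2 (T @^-1` (B `\` P)) - mass m1 (T @^-1` (B `\` P)).
    by rewrite m1T ?m2T; [rewrite (pE _ mB).2|exact: mD|exact: mD].
  have mC := mT _ (mD _ mB).
  have := mass_ge0 p1 (T @^-1` (B `\` P)); rewrite (pE _ mC).1.
  have : mass p2 (T @^-1` (B `\` P)) <= mass p2 (T @^-1` B).
    by apply: le_mass => //; [exact: mT|move=> x []].
  by rewrite (pE _ mC).2 (@massID _ _ _ m1 _ P mC)// (@massID _ _ _ m2 _ P mC)//; lra.
have ac0 (m : {finite_measure set X -> \bar R}) B C :
    (forall A, measurable A -> lam A = 0%E -> m A = 0%E) ->
    measurable B -> measurable C -> C `<=` B -> lam B = 0%E -> mass m C = 0.
  move=> mac mB mC CB B0; apply/eqP; rewrite eq_le mass_ge0 andbT.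
  by rewrite -[leRHS](_ : mass m B = 0) ?le_mass// /mass mac.
have p1ac B : measurable B -> lam B = 0%E -> p1 B = 0%E.
  move=> mB B0; apply: mass_eq0 => //; rewrite (pE _ mB).1.
  by rewrite (ac0 m1 B)//; [rewrite (ac0 m2 B) ?subrr//; exact: mI|exact: mI].
have p2ac B : measurable B -> lam B = 0%E -> p2 B = 0%E.
  move=> mB B0; apply: mass_eq0 => //; rewrite (pE _ mB).2.
  by rewrite (ac0 m1 B)//; [rewrite (ac0 m2 B) ?subrr//; exact: mD|exact: mD].
have pTE : mass p1 setT = mass p2 setT.
  rewrite (pE _ measurableT).1 (pE _ measurableT).2.
  by move: m12; rewrite (@massID _ _ _ m1 _ P)// (@massID _ _ _ m2 _ P)//; lra.
have p10 : mass p1 (~` P) = 0.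
  by rewrite (pE _ (measurableC mP)).1 setICl !mass_set0 subrr.
have p20 : mass p2 (~` ~` P) = 0.
  by rewrite setCK (pE _ mP).2 setDv !mass_set0 subrr.
have e0 : 0 < near0 by rewrite divr_gt0 ?mulr_gt0 ?subr_gt0.
have e1 : near0 <= 1 by rewrite ler_pdivrMr ?mulr_gt0//; move: b1; lra.
have p0 : mass p1 setT = 0.
  apply/eqP; rewrite eq_le mass_ge0 andbT leNgt; apply/negP => p1T0.
  have p2T0 := p1T0; rewrite pTE in p2T0.
  have h1 := invariant_contains_near0 p1T p1ac p1T0 mP p10.
  have h2 := invariant_contains_near0 p2T p2ac p2T0 (measurableC mP) p20.
  have mE : measurable (@segment R 0 near0) by exact: measurable_segment.
  have := @massID _ _ _ lam _ P mE mP; rewrite h1 addr0.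
  move: h2; rewrite setDE setCK => ->; rewrite mass_segment ?(ltW e0)// subr0.
  by move=> en; move: e0; rewrite en ltxx.
move=> A mA; rewrite !massE//; congr EFin.
have q0 (p : {finite_measure set X -> \bar R}) : mass p setT = 0 -> mass p A = 0.
  move=> p00; apply/eqP; rewrite eq_le mass_ge0 andbT -p00.
  exact: le_mass.
have := q0 _ p0; have := q0 p2; rewrite -pTE => /(_ p0).
rewrite (pE _ mA).1 (pE _ mA).2 (@massID _ _ _ m1 _ P mA)// (@massID _ _ _ m2 _ P mA)//.
by lra.
Qed.

End Uniqueness.

(** * Singular jointly invariant measures *)

Section Expectation.
Context d {T : measurableType d} {R : realType}.
Variable m : {finite_measure set T -> \bar R}.
Implicit Types (f g : T -> R) (A : set T).

Lemma eq_measure_of_mass A B : measurable A -> measurable B ->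
  mass m A = mass m B -> m A = m B.
Proof. by move=> mA mB AB; rewrite !massE// AB. Qed.

(** Boundedness rather than integrability: it implies integrability for a finite measure and
    survives composition with any measurable map. *)
Definition bounded_measurable f :=
  measurable_fun [set: T] f /\ exists M, forall x, `|f x| <= M.

Definition mean f : R := \int[m]_x f x.

Lemma bounded_measurable_integrable f : bounded_measurable f ->
  m.-integrable [set: T] (EFin \o f).
Proof.
move=> [mf [M fM]]; apply: measurable_bounded_integrable => //.
  exact: finite_measure_lty.
exists M; split; first exact: num_real.
by move=> y My x _; exact: le_trans (fM x) (ltW My).
Qed.

Lemma bounded_measurable_cst (r : R) : bounded_measurable (fun=> r).
Proof. by split; [exact: measurable_cst|exists `|r|]. Qed.

Lemma bounded_measurableD f g : bounded_measurable f -> bounded_measurable g ->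
  bounded_measurable (fun x => f x + g x).
Proof.
move=> [mf [M fM]] [mg [N gN]]; split; first exact: measurable_funD.
by exists (M + N) => x; rewrite (le_trans (ler_normD _ _))// lerD.
Qed.

Lemma bounded_measurableZ r f : bounded_measurable f ->
  bounded_measurable (fun x => r * f x).
Proof.
move=> [mf [M fM]]; split; first exact: measurable_funM.
by exists (`|r| * M) => x; rewrite normrM ler_wpM2l.
Qed.

Lemma bounded_measurableB f g : bounded_measurable f -> bounded_measurable g ->
  bounded_measurable (fun x => f x - g x).
Proof.
move=> bf bg; have := bounded_measurableD bf (bounded_measurableZ (-1) bg).
by congr bounded_measurable; apply/funext => x; rewrite mulN1r.
Qed.

Lemma bounded_measurable_sum n (F : nat -> T -> R) :
  (forall i, bounded_measurable (F i)) ->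
  bounded_measurable (fun x => \sum_(i < n) F i x).
Proof.
move=> bF; elim: n => [|n IHn].
  under eq_fun do rewrite big_ord0; exact: bounded_measurable_cst.
by under eq_fun do rewrite big_ord_recr/=; exact: bounded_measurableD.
Qed.

Lemma bounded_measurable_indic A : measurable A -> bounded_measurable (\1_A : T -> R).
Proof.
move=> mA; split; first exact: measurable_indic.
by exists 1 => x; rewrite indicE; case: (_ \in _); rewrite ?normr1 ?normr0.
Qed.

Lemma bounded_measurable_comp f (F : T -> T) : measurable_fun [set: T] F ->
  bounded_measurable f -> bounded_measurable (f \o F).
Proof.
move=> mF [mf [M fM]]; split; first exact: measurableT_comp.
by exists M => x; exact: fM.
Qed.

Lemma meanD f g : bounded_measurable f -> bounded_measurable g ->
  mean (fun x => f x + g x) = mean f + mean g.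
Proof. by move=> bf bg; apply: RintegralD => //; exact: bounded_measurable_integrable. Qed.

Lemma meanZ r f : bounded_measurable f -> mean (fun x => r * f x) = r * mean f.
Proof. by move=> bf; apply: RintegralZl => //; exact: bounded_measurable_integrable. Qed.

Lemma meanB f g : bounded_measurable f -> bounded_measurable g ->
  mean (fun x => f x - g x) = mean f - mean g.
Proof. by move=> bf bg; apply: RintegralB => //; exact: bounded_measurable_integrable. Qed.

Lemma le_mean f g : bounded_measurable f -> bounded_measurable g ->
  (forall x, f x <= g x) -> mean f <= mean g.
Proof.
by move=> bf bg fg; apply: le_Rintegral => //; exact: bounded_measurable_integrable.
Qed.

Lemma mean_indic A : measurable A -> mean (\1_A) = mass m A.
Proof. by move=> mA; rewrite /mean /Rintegral integral_indic// setIT. Qed.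

Lemma mean_sum n (F : nat -> T -> R) : (forall i, bounded_measurable (F i)) ->
  mean (fun x => \sum_(i < n) F i x) = \sum_(i < n) mean (F i).
Proof.
move=> bF; elim: n => [|n IHn].
  rewrite big_ord0; under [X in mean X]eq_fun do rewrite big_ord0.
  by rewrite /mean /Rintegral integral0.
rewrite big_ord_recr/= -IHn -meanD//; last exact: bounded_measurable_sum.
by congr mean; apply/funext => x; rewrite big_ord_recr.
Qed.

Lemma mean_comp f (F : T -> T) : measurable_fun [set: T] F ->
  (forall A, measurable A -> mass m (F @^-1` A) = mass m A) ->
  bounded_measurable f -> mean (f \o F) = mean f.
Proof.
move=> mF FE bf; rewrite /mean /Rintegral; congr fine.
have := @integral_pushforward _ _ T T R F mF m setT (EFin \o f).
rewrite preimage_setT => <-//; last first.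
- by apply: bounded_measurable_integrable; exact: bounded_measurable_comp.
- by apply/measurable_EFinP; case: bf.
apply: eq_measure_integral => A mA _; apply: eq_measure_of_mass => //; last exact: FE.
by rewrite -[X in measurable X]setTI; exact: mF.
Qed.

Lemma markov_mass f (c : R) : 0 < c -> bounded_measurable f -> (forall x, 0 <= f x) ->
  c * mass m [set x | c <= f x] <= mean f.
Proof.
move=> c0 bf f0.
have mA : measurable [set x | c <= f x].
  rewrite (_ : mkset _ = setT `&` f @^-1` [set` `[c, +oo[]); last first.
    by apply/seteqP; split=> x /=; rewrite in_itv/= andbT => // -[].
  by case: bf => mf _; apply: mf => //; exact: measurable_itv.
rewrite -mean_indic// -meanZ; last exact: bounded_measurable_indic.
apply: le_mean => // [|x].
  by apply: bounded_measurableZ; exact: bounded_measurable_indic.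
rewrite indicE; have [/set_mem/= cf|_] := boolP (x \in _); first by rewrite mulr1.
by rewrite mulr0.
Qed.

End Expectation.

Section SmallMultiples.
Context {R : realType}.

(** The pigeonhole principle gives a multiple of [y] at a small nonzero distance [w] from an
    integer. If [w] is negative, a further multiple is needed to come out just above an integer. *)
Lemma fractional_part_mul_small (y e : R) : (forall n : nat, (0 < n)%N ->
    fractional_part (n%:R * y) != 0) -> 0 < e ->
  exists n : nat, 0 < fractional_part (n%:R * y) < e.
Proof.
move=> yirr e0; pose M := (Num.truncn e^-1).+1.
have M0 : 0 < M%:R :> R by [].
have eM : M%:R^-1 < e by rewrite invf_plt ?posrE// truncnS_gt.
have box (i : 'I_M.+1) : (Num.truncn (M%:R * fractional_part (i%:R * y)) < M)%N.
  rewrite truncn_lt_nat ?mulr_ge0 ?fractional_part_ge0//.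
  by rewrite -[ltRHS]mulr1 ltr_pM2l// fractional_part_lt1.
pose f (i : 'I_M.+1) : 'I_M := Ordinal (box i).
have /injectivePn[i [j ij fij]] : ~~ injectiveb f.
  apply/negP => /injectiveP /leq_card; rewrite !card_ord.
  by rewrite ltnn.
wlog ltij : i j ij fij / (i < j)%N.
  move=> H; have := ij; rewrite neq_ltn => /orP[|ji]; first exact: H.
  by apply: (H j i) => //; rewrite eq_sym.
pose dd : nat := (j - i)%N; have d0 : (0 < dd)%N by rewrite subn_gt0.
have ydE : dd%:R * y = j%:R * y - i%:R * y :> R by rewrite natrB ?mulrBl// ltnW.
have close : `|fractional_part (j%:R * y) - fractional_part (i%:R * y)| < M%:R^-1.
  have /(congr1 val)/= := fij.
  have Mfi := mulr_ge0 (ltW M0) (fractional_part_ge0 (i%:R * y)).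
  have Mfj := mulr_ge0 (ltW M0) (fractional_part_ge0 (j%:R * y)).
  have := truncn_itv Mfi; have := truncn_itv Mfj; move=> /[swap] + /[swap] tE.
  rewrite tE -natr1 => /andP[h1 h2] /andP[h3 h4].
  rewrite -(ltr_pM2l M0) mulfV ?gt_eqF// -[X in X * _](ger0_norm (ltW M0)) -normrM.
  by rewrite ltr_norml; apply/andP; split; lra.
have [z zE] : exists z : int, dd%:R * y =
    fractional_part (j%:R * y) - fractional_part (i%:R * y) + z%:~R.
  exists (Num.floor (j%:R * y) - Num.floor (i%:R * y)).
  by rewrite ydE /fractional_part rmorphB/=; ring.
move: zE close; set w := _ - _ => zE wM.
have w0 : w != 0.
  apply: contraNneq (yirr _ d0) => w0.
  by rewrite zE w0 fractional_partDz fractional_part0.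
have w1 : `|w| < 1 by apply: lt_le_trans wM _; rewrite invf_le1// ler1n.
have [wneg|wpos|/eqP] := ltgtP w 0; last by rewrite (negPf w0).
  have nw0 : 0 < - w by rewrite oppr_gt0.
  have nw1 : 0 <= (- w)^-1 by rewrite invr_ge0 ltW.
  (* With [t] the integer part of [1 / (- w)], the number [1 + t w] lies in [[0, - w)];
     irrationality excludes [0]. *)
  have := truncn_itv nw1; set t := Num.truncn _ => /andP[].
  rewrite -natr1 -(ler_pM2r nw0) -(ltr_pM2r nw0) mulVf ?gt_eqF// => tw tw1.
  have nwM : - w < M%:R^-1 by rewrite -(ltr0_norm wneg).
  have nw_lt1 : - w < 1 by rewrite -(ltr0_norm wneg).
  have tE : fractional_part ((t * dd)%:R * y) = t%:R * w + 1.
    rewrite natrM -mulrA zE mulrDr [t%:R * z%:~R](_ : _ = (t%:Z * z)%:~R); last first.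
      by rewrite intrM.
    rewrite fractional_partDz (@fractional_part_eq _ (-1)) ?rmorphN1 ?opprK//.
    by apply/andP; split; lra.
  have t0 : (0 < t)%N.
    by rewrite lt0n; apply/negP => /eqP t0; move: tw1; rewrite t0 add0r mul1r; lra.
  exists (t * dd)%N; rewrite lt_neqAle eq_sym yirr ?muln_gt0 ?t0//= fractional_part_ge0 tE/=.
  by lra.
exists dd; rewrite zE fractional_partDz fractional_part_id.
  by rewrite wpos (lt_trans _ eM)// -(gtr0_norm wpos).
by rewrite ltW//= -(gtr0_norm wpos).
Qed.

End SmallMultiples.

Section FiniteSum.
Context d {T : measurableType d} {R : realType}.
Variables (ms : nat -> {finite_measure set T -> \bar R}) (n : nat).

Definition finite_msum := msum ms n.

HB.instance Definition _ := Measure.on finite_msum.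

Let finite_msum_fin : fin_num_fun finite_msum.
Proof.
by move=> A mA; rewrite /finite_msum /msum; apply/sum_fin_numP => i _ _; exact: fin_num_measure.
Qed.

HB.instance Definition _ := @Measure_isFinite.Build _ _ _ finite_msum finite_msum_fin.

Lemma mass_finite_msum A : measurable A ->
  mass finite_msum A = \sum_(i < n) mass (ms i) A.
Proof.
move=> mA; rewrite /mass /= /finite_msum /msum -sum_fine// => i _.
exact: fin_num_measure.
Qed.

End FiniteSum.

(** * Bounded remainder arcs for the rotation by [beta] *)

Section RotationCocycle.
Context {R : realType}.
Variable beta : R.
Implicit Types (y s : R) (n a : nat).

(** Modulo [1], the point [y] lies in the arc [[s - {n beta}, s)]. *)
Definition hit n s y : bool := 1 - fractional_part (n%:R * beta) <= fractional_part (y - s).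

(** Hecke's transfer function for the arc of [hit]: its increment under rotation by [beta] is the
    length of the arc minus the indicator of the arc. *)
Definition sawtooth_sum n s y : R := \sum_(i < n) fractional_part (y + i%:R * beta - s).

Lemma fractional_partD (t al : R) :
  fractional_part (t + al) = fractional_part t + fractional_part al -
    (1 - fractional_part al <= fractional_part t)%R%:R.
Proof.
have := fractional_part_itv t; have := fractional_part_itv al.
have [h|h] := leP (1 - fractional_part al) (fractional_part t) => /andP[a0 a1] /andP[t0 t1].
  rewrite (@fractional_part_congr _ _ (fractional_part t + fractional_part al)
    (Num.floor t + Num.floor al)).
    by rewrite (@fractional_part_eq _ 1)//; apply/andP; split; lra.
  by rewrite /fractional_part intrD; ring.
rewrite (@fractional_part_congr _ _ (fractional_part t + fractional_part al)
    (Num.floor t + Num.floor al)).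
  by rewrite (@fractional_part_eq _ 0)//; apply/andP; split; lra.
by rewrite /fractional_part intrD; ring.
Qed.

(** The increment telescopes to the sawtooth at [y + n beta] minus the one at [y]; adding [{n beta}]
    wraps around exactly on the arc. *)
Lemma sawtooth_sum_step n s y : sawtooth_sum n s (y + beta) =
  sawtooth_sum n s y + fractional_part (n%:R * beta) - (hit n s y)%:R.
Proof.
suff : sawtooth_sum n s (y + beta) - sawtooth_sum n s y =
    fractional_part (y + n%:R * beta - s) - fractional_part (y - s).
  rewrite (addrAC y (n%:R * beta) (- s)) (fractional_partD (y - s) (n%:R * beta)).
  rewrite -/(hit n s y) => h.
  by rewrite -[LHS](subrK (sawtooth_sum n s y)) h; ring.
rewrite /sawtooth_sum; elim: n => [|n IHn]; first by rewrite !big_ord0 mul0r addr0 !subrr.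
rewrite !big_ord_recr/= opprD addrACA IHn -natr1.
rewrite (_ : y + beta + _ - s = y + (n%:R + 1) * beta - s); last by ring.
by ring.
Qed.

Lemma sawtooth_sum_iter n s y a : sawtooth_sum n s (y + a%:R * beta) =
  sawtooth_sum n s y + a%:R * fractional_part (n%:R * beta) -
    \sum_(i < a) (hit n s (y + i%:R * beta))%:R.
Proof.
elim: a => [|a IHa]; first by rewrite big_ord0 !mul0r !addr0 subr0.
rewrite big_ord_recr/= -natr1 mulrDl mul1r addrA sawtooth_sum_step IHa.
by ring.
Qed.

(** Both points are reached from the common base [y] by forward steps, so displacements of either
    sign are covered, and the error counts hits along one fixed window of [M] positions. *)
Lemma sawtooth_sum_diff n s y (a c M : nat) : (a <= M)%N -> (c <= M)%N ->
  `|sawtooth_sum n s (y + a%:R * beta) - sawtooth_sum n s (y + c%:R * beta) -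
    (a%:R - c%:R) * fractional_part (n%:R * beta)| <=
  \sum_(i < M) (hit n s (y + i%:R * beta))%:R.
Proof.
move=> aM cM; rewrite !sawtooth_sum_iter.
have S e : (e <= M)%N -> 0 <= (\sum_(i < e) (hit n s (y + i%:R * beta))%:R : R) <=
    \sum_(i < M) (hit n s (y + i%:R * beta))%:R.
  move=> eM; rewrite sumr_ge0//= -(subnKC eM) big_split_ord/= lerDl.
  by rewrite sumr_ge0.
move: (S _ aM) (S _ cM) => /andP[a0 aS] /andP[c0 cS].
by rewrite ler_norml; apply/andP; split; lra.
Qed.

End RotationCocycle.

Section NullImage.
Context {R : realType}.
Local Notation X := (unit_interval R).
Local Notation lam := (@unit_lebesgue R).

(** The reduction modulo [1] of an affine image is covered by countably many integer translates of
    it, each of them null. *)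
Lemma null_affine_image (a c : R) (B : set X) : 0 < a -> measurable B -> lam B = 0%E ->
  exists D : set X, [/\ measurable D, lam D = 0%E &
    forall w, B w -> D (to_unit (a * unit_val w + c))].
Proof.
(* [h] enumerates all integers; numbers that code no integer merely repeat [0]. *)
move=> a0 mB B0; pose h (n : nat) : R := (odflt 0 (unpickle n : option int))%:~R.
pose g n (r : R) : R := a^-1 * r + - (a^-1 * (c + h n)).
have mg n : measurable (g n @^-1` (@unit_val R @` B) : set (measurableTypeR R)).
  rewrite -[X in measurable X]setTI.
  have mgn : measurable_fun [set: measurableTypeR R] (g n).
    by apply: measurable_funD => //; exact: measurable_funM.
  by apply: mgn => //; exact: measurable_unit_image.
pose F n : set X := @unit_val R @^-1` (g n @^-1` (@unit_val R @` B)).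
have mF n : measurable (F n) by apply: measurable_unit_val_preimage.
exists (\bigcup_n F n); split; first exact: bigcupT_measurable.
  apply: measure_bigcup0 => // n; apply/eqP; rewrite eq_le measure_ge0 andbT.
  apply: (@le_trans _ _ (lebesgue_measure (g n @^-1` (@unit_val R @` B)))).
    apply: le_measure; rewrite ?inE//; first exact: measurable_unit_image.
    by move=> _ [y Fy <-].
  rewrite lebesgue_affine ?invr_gt0//; last exact: measurable_unit_image.
  by rewrite [lebesgue_measure _](_ : _ = lam B)// B0 mule0.
move=> w Bw; exists (pickle (- Num.floor (a * unit_val w + c))) => //.
exists w => //; rewrite /g /h pickleK /= /fractional_part rmorphN/=.
by field; rewrite gt_eqF.
Qed.

End NullImage.

Section SingularPart.
Context {R : realType}.
Local Notation X := (unit_interval R).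
Local Notation lam := (@unit_lebesgue R).
Variables (beta gamma : R) (N : nat) (p q : int).
Hypothesis N0 : (0 < N)%N.
Hypothesis NE : N%:R * gamma = p%:~R * beta + q%:~R.
Hypothesis beta_irr : forall n : nat, (0 < n)%N -> fractional_part (n%:R * beta) != 0.
Hypothesis pqN : p + q != N%:Z.
Variable m : {finite_measure set X -> \bar R}.
Hypothesis mbeta : forall A, measurable A -> mass m (beta_map beta @^-1` A) = mass m A.
Hypothesis mgamma : forall A, measurable A -> mass m (beta_map gamma @^-1` A) = mass m A.
Local Notation U x := (unit_val (x : X) : R).

Let digit (b : R) (x : X) : int := Num.floor (b * U x).

(** In [N (Tgb x - Tbg x)] the terms in [beta gamma x] cancel, and [NE] turns [N gamma] into
    [p beta + q]; this is the coefficient of [beta] that remains, everything else being an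
    integer. *)
Let cocycle (x : X) : int := N%:Z * digit gamma x - p * digit beta x.

Let Tbg (x : X) : X := beta_map beta (beta_map gamma x).
Let Tgb (x : X) : X := beta_map gamma (beta_map beta x).

Let val_beta_map b x : U (beta_map b x) = b * U x - (digit b x)%:~R.
Proof. by []. Qed.

Let commutation x : exists z : int,
  N%:R * U (Tgb x) = N%:R * U (Tbg x) + (cocycle x)%:~R * beta + z%:~R.
Proof.
exists (N%:Z * (digit beta (beta_map gamma x) - digit gamma (beta_map beta x)) -
        q * digit beta x).
rewrite /cocycle /Tgb /Tbg !val_beta_map !(intrM, intrB) -!pmulrn.
set k := (digit beta x)%:~R; set l := (digit gamma x)%:~R.
set k' := (digit gamma _)%:~R; set l' := (digit beta _)%:~R.
apply/eqP; rewrite -subr_eq0; apply/eqP.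
transitivity (- k * (N%:R * gamma - (p%:~R * beta + q%:~R))); first by ring.
by rewrite NE subrr mulr0.
Qed.

Let mTbg : measurable_fun [set: X] Tbg.
Proof. exact: (measurableT_comp (measurable_beta_map beta) (measurable_beta_map gamma)). Qed.

Let mTgb : measurable_fun [set: X] Tgb.
Proof. exact: (measurableT_comp (measurable_beta_map gamma) (measurable_beta_map beta)). Qed.

Let Tbg_inv A : measurable A -> mass m (Tbg @^-1` A) = mass m A.
Proof.
move=> mA; rewrite (_ : _ @^-1` A = beta_map gamma @^-1` (beta_map beta @^-1` A))//.
rewrite mgamma ?mbeta//.
by apply: measurable_preimage => //; exact: measurable_beta_map.
Qed.

Let Tgb_inv A : measurable A -> mass m (Tgb @^-1` A) = mass m A.
Proof.
move=> mA; rewrite (_ : _ @^-1` A = beta_map beta @^-1` (beta_map gamma @^-1` A))//.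
rewrite mbeta ?mgamma//.
by apply: measurable_preimage => //; exact: measurable_beta_map.
Qed.

Let bm_val : bounded_measurable (@unit_val R).
Proof.
split; first exact: measurable_unit_val.
by exists 1 => x; rewrite ger0_norm ?unit_val_ge0// ltW// unit_val_lt1.
Qed.

Let digitE (b : R) x : (digit b x)%:~R = b * U x - U (beta_map b x).
Proof. by rewrite val_beta_map opprB addrC subrK. Qed.

Let bm_beta_map b : bounded_measurable (fun x => U (beta_map b x)).
Proof. exact: (bounded_measurable_comp (measurable_beta_map b) bm_val). Qed.

Let cocycleE x : (cocycle x)%:~R =
  N%:R * (gamma * U x - U (beta_map gamma x)) - p%:~R * (beta * U x - U (beta_map beta x)).
Proof. by rewrite /cocycle !(intrM, intrB) !digitE -pmulrn. Qed.

Let bm_cocycle : bounded_measurable (fun x => (cocycle x)%:~R : R).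
Proof.
rewrite (_ : (fun x => _) = fun x => N%:R * (gamma * U x - U (beta_map gamma x)) -
  p%:~R * (beta * U x - U (beta_map beta x))); last exact/funext/cocycleE.
by apply: bounded_measurableB; apply: bounded_measurableZ; apply: bounded_measurableB => //;
  apply: bounded_measurableZ.
Qed.

Let mean_val_beta_map b : (forall A, measurable A -> mass m (beta_map b @^-1` A) = mass m A) ->
  mean m (fun x => U (beta_map b x)) = mean m (@unit_val R).
Proof. by move=> mb; apply: (mean_comp (measurable_beta_map b) mb). Qed.

(** A digit in base [b] is [b x - T_b x], so invariance gives it mean [(b - 1)] times the mean of
    [x]; in the cocycle the multiples of [beta] cancel. *)
Let mean_cocycle : mean m (fun x => (cocycle x)%:~R : R) =
  (p + q - N%:Z)%:~R * mean m (@unit_val R).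
Proof.
rewrite (_ : (fun x => _) = fun x => N%:R * (gamma * U x - U (beta_map gamma x)) -
  p%:~R * (beta * U x - U (beta_map beta x))); last exact/funext/cocycleE.
have bmZ b : bounded_measurable (fun x => b * U x) by exact: bounded_measurableZ.
have bmd b : bounded_measurable (fun x => b * U x - U (beta_map b x)).
  exact: bounded_measurableB.
rewrite meanB; [|exact: bounded_measurableZ..].
rewrite !(meanZ _ _ (bmd _)) !(meanB _ (bmZ _) (bm_beta_map _)) !(meanZ _ _ bm_val).
rewrite !mean_val_beta_map//.
rewrite (_ : N%:R * _ = (N%:R * gamma - N%:R) * mean m (@unit_val R)); last by ring.
rewrite NE !(intrB, intrD) -pmulrn.
by ring.
Qed.

Let cocycle_bound : exists C : nat, forall x, (`|cocycle x| <= C)%N.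
Proof.
have [_ [M jM]] := bm_cocycle; exists (Num.truncn M).+1 => x.
have M0 : 0 <= M by apply: le_trans (jM x).
rewrite -(ler_nat R) natr_absz intr_norm (le_trans (jM x))// ltW//.
exact: truncnS_gt.
Qed.

Let bm_sawtooth n s : bounded_measurable (fun x => sawtooth_sum beta n s (N%:R * U x)).
Proof.
apply: (@bounded_measurable_sum _ _ _ n
  (fun i x => fractional_part (N%:R * U x + i%:R * beta - s))) => i; split; last first.
  by exists 1 => x; rewrite ger0_norm ?fractional_part_ge0// ltW// fractional_part_lt1.
apply: (measurableT_comp (@measurable_fractional_part R)).
apply: measurable_funB => //; apply: measurable_funD => //.
by apply: measurable_funM => //; exact: measurable_unit_val.
Qed.

(** The base point is moved back by [C] rotations, so that displacements between [- C] and [C]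
    become forward indices between [0] and [2 C]. *)
Let hit_set C n s i : set X :=
  [set x | hit beta n s (N%:R * U (Tbg x) - C%:R * beta + i%:R * beta)].

Let measurable_hit_set C n s i : measurable (hit_set C n s i).
Proof.
pose f (x : X) := fractional_part (N%:R * U (Tbg x) - C%:R * beta + i%:R * beta - s).
have mf : measurable_fun [set: X] f.
  apply: (measurableT_comp (@measurable_fractional_part R)).
  apply: measurable_funB => //; apply: measurable_funD => //; apply: measurable_funB => //.
  apply: measurable_funM => //.
  exact: (measurableT_comp measurable_unit_val mTbg).
rewrite (_ : hit_set _ _ _ _ =
    setT `&` f @^-1` [set` `[1 - fractional_part (n%:R * beta), +oo[]).
  by apply: mf => //; exact: measurable_itv.
by apply/seteqP; split=> x; rewrite /= in_itv/= andbT// => -[].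
Qed.

Let sawtooth_int n s (y : R) (z : int) :
  sawtooth_sum beta n s (y + z%:~R) = sawtooth_sum beta n s y.
Proof.
by apply: eq_bigr => i _; apply: (@fractional_part_congr _ _ _ z); ring.
Qed.

(** Integrate [sawtooth_sum_diff] along [commutation]: both compositions preserve [m], so the two
    sawtooth means cancel and only the mean of the cocycle remains against the hits. *)
Let mean_cocycle_le C n s : (forall x, (`|cocycle x| <= C)%N) ->
  fractional_part (n%:R * beta) * `|mean m (fun x => (cocycle x)%:~R : R)| <=
  \sum_(i < C + C) mass m (hit_set C n s i).
Proof.
move=> jC; set al := fractional_part _.
pose th (x : X) := sawtooth_sum beta n s (N%:R * U x).
pose f x := th (Tgb x) - th (Tbg x) - al * (cocycle x)%:~R.
pose H x : R := \sum_(i < C + C) \1_(hit_set C n s i) x.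
have bmth : bounded_measurable th by exact: bm_sawtooth.
have bm1 : bounded_measurable (fun x => th (Tgb x)) by exact: (bounded_measurable_comp mTgb).
have bm2 : bounded_measurable (fun x => th (Tbg x)) by exact: (bounded_measurable_comp mTbg).
have bm3 : bounded_measurable (fun x => al * (cocycle x)%:~R) by exact: bounded_measurableZ.
have bmf : bounded_measurable f by do 2 apply: bounded_measurableB => //.
have bmi i : bounded_measurable (\1_(hit_set C n s i) : X -> R).
  by apply: bounded_measurable_indic; exact: measurable_hit_set.
have bmH : bounded_measurable H.
  exact: (@bounded_measurable_sum _ _ _ _ (fun i => \1_(hit_set C n s i))).
have fH x : `|f x| <= H x.
  have [a aE] : exists a : nat, a%:Z = cocycle x + C%:Z.
    exists (absz (cocycle x + C%:Z)%R); rewrite gez0_abs//.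
    have := jC x; lia.
  have aC : (a <= C + C)%N by have := jC x; lia.
  have := @sawtooth_sum_diff R beta n s (N%:R * U (Tbg x) - C%:R * beta) a C (C + C) aC
    (leq_addr _ _).
  have aR : a%:R = (cocycle x)%:~R + C%:R :> R by rewrite [LHS]pmulrn aE intrD.
  rewrite subrK aR mulrDl addrA.
  rewrite [_ - C%:R * beta + _ + _](_ : _ = N%:R * U (Tbg x) + (cocycle x)%:~R * beta);
    last by ring.
  rewrite addrK; have [z zE] := commutation x.
  rewrite -(sawtooth_int _ _ _ z) -zE [(cocycle x)%:~R * fractional_part _]mulrC.
  move=> /le_trans; apply.
  rewrite /H ler_sum// => i _; rewrite indicE.
  have [hx|hx] := boolP (hit _ _ _ _); last by [].
  by rewrite mem_set.
have mf : mean m f = - al * mean m (fun x => (cocycle x)%:~R : R).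
  rewrite /f meanB//; last exact: bounded_measurableB.
  rewrite meanB// meanZ// (mean_comp mTgb Tgb_inv bmth) (mean_comp mTbg Tbg_inv bmth).
  by rewrite subrr sub0r mulNr.
have mH : mean m H = \sum_(i < C + C) mass m (hit_set C n s i).
  rewrite /H (@mean_sum _ _ _ m _ (fun i => \1_(hit_set C n s i)))//.
  by apply: eq_bigr => i _; rewrite mean_indic.
have al0 : 0 <= al by exact: fractional_part_ge0.
rewrite -mH -[X in X * _](ger0_norm al0) -normrM -normrN -mulNr -mf.
rewrite ler_norml; apply/andP; split.
  rewrite -mulN1r -meanZ//; apply: le_mean => // [|x]; first exact: bounded_measurableZ.
  by move: (fH x); rewrite ler_norml mulN1r => /andP[].
by apply: le_mean => // x; move: (fH x); rewrite ler_norml => /andP[].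
Qed.

(** Otherwise the sum [k] of [2 C] rotated laws of [N * Tbg x] charges arcs proportionally to their
    length and hence dominates a multiple of [lam], although it is carried by affine images modulo
    [1] of the null set [B]. *)
Lemma singular_mean0 (B : set X) : measurable B -> lam B = 0%E -> m (~` B) = 0%E ->
  mean m (@unit_val R) = 0.
Proof.
move=> mB B0 mB0; apply/eqP/negPn/negP => m0.
have [C jC] := cocycle_bound.
set E := `|mean m (fun x => (cocycle x)%:~R : R)|.
have E0 : 0 < E.
  by rewrite normr_gt0 mean_cocycle mulf_neq0// intr_eq0 subr_eq0.
have mZ i : measurable_fun [set: X]
    (to_unit \o (fun x => N%:R * U (Tbg x) - C%:R * beta + i%:R * beta)).
  apply: measurable_fun_to_unit; apply: measurable_funD => //.
  apply: measurable_funB => //; apply: measurable_funM => //.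
  exact: (measurableT_comp measurable_unit_val mTbg).
pose k : {finite_measure set X -> \bar R} :=
  finite_msum (fun i => finite_pushforward m (mZ i)) (C + C).
have kE A : measurable A -> mass k A = \sum_(i < C + C) mass (finite_pushforward m (mZ i)) A.
  exact: mass_finite_msum.
(* The bounds on [s] keep the arc [[s - {n beta}, s)] from wrapping around, so hitting it means
   lying in a segment. *)
have kge n s : fractional_part (n%:R * beta) <= s -> s <= 1 ->
    fractional_part (n%:R * beta) * E <= mass k (segment (s - fractional_part (n%:R * beta)) s).
  move=> als s1; rewrite kE; last exact: measurable_segment.
  apply: le_trans (mean_cocycle_le n s jC) _; apply: ler_sum => i _.
  apply: le_mass => //.
    by apply: measurable_preimage => //; exact: measurable_segment.
  move=> x; rewrite /hit_set /hit/=; set y := _ + _ * beta.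
  rewrite [fractional_part (y - s)](@fractional_part_congr _ _
    (fractional_part y - s) (Num.floor y)); last by rewrite /fractional_part; ring.
  move=> h; suff : s - fractional_part (n%:R * beta) <= fractional_part y < s by [].
  apply/andP; move: als h; set al := fractional_part (n%:R * beta) => als h.
  have := fractional_part_itv y => /andP[y0 y1].
  have [ys|sy] := ltP (fractional_part y) s.
    move: h; rewrite (@fractional_part_eq _ (-1)) ?rmorphN1 ?opprK.
      by move=> h; split=> //; lra.
    by apply/andP; split; lra.
  move: h; rewrite (@fractional_part_eq _ 0) mulr0z subr0; first by lra.
  have al0 : 0 <= al by exact: fractional_part_ge0.
  by apply/andP; split; lra.
have N0' : 0 < N%:R :> R by rewrite ltr0n.
have DP i := cid (null_affine_image (- (C%:R * beta) + i%:R * beta) N0' mB B0).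
pose D i := projT1 (DP i).
have mD : measurable (\bigcup_i D i).
  by apply: bigcupT_measurable => i; case: (projT2 (DP i)).
have D0 : lam (\bigcup_i D i) = 0%E.
  by apply: measure_bigcup0 => i; case: (projT2 (DP i)).
suff : lam (~` \bigcup_i D i) = 0%E.
  move=> D0'; have := @massID _ _ _ lam setT _ measurableT mD.
  rewrite setTI setTD mass_lam_setT (eq0_mass D0) (eq0_mass D0') addr0 => /eqP.
  by rewrite oner_eq0.
(* Half of [E] is lost on the last interval of the subdivision: it may be almost [2 al] long, but
   only its first stretch of length [al] is estimated. *)
apply: (@lam_null_of_chains _ k (E / 2)); [by rewrite divr_gt0|exact: measurableC| |].
  move=> e e0.
  (* Halving [e] leaves room for that double-length interval; halving [1] guarantees at least one
     arc. *)
  have emin : 0 < Num.min e 1 / 2 by rewrite divr_gt0// lt_min e0 ltr01.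
  have [n /andP[al0]] := fractional_part_mul_small beta_irr emin.
  rewrite ltr_pdivlMr// lt_min => /andP[ale al1].
  move: al0 ale al1 (kge n); set al := fractional_part _ => al0 ale al1 {}kge.
  have ali : 0 <= al^-1 by rewrite invr_ge0 ltW.
  have := truncn_itv ali; set K := Num.truncn _ => /andP[].
  rewrite -natr1 -(ler_pM2r al0) -(ltr_pM2r al0) mulVf ?gt_eqF// => K1 K2.
  have K0 : (0 < K)%N.
    by rewrite lt0n; apply/negP => /eqP K0; move: K2; rewrite K0 add0r; lra.
  have full j : (j < K)%N -> chain (fun l r =>
      [/\ l <= r, r - l <= e & E / 2 * (r - l) <= mass k (segment l r)]) 0 (j%:R * al).
    elim: j => [|j IHj] jK; first by rewrite mul0r; exact: chain_nil.
    apply: chain_cat (IHj (ltnW jK)) _; apply: chain1.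
    have jal : (j%:R + 1) * al <= K%:R * al by rewrite ler_pM2r// natr1 ler_nat ltnW.
    have jal0 : 0 <= j%:R * al by rewrite mulr_ge0// ltW.
    rewrite -natr1; have := kge ((j%:R + 1) * al).
    rewrite (_ : (j%:R + 1) * al - al = j%:R * al); last by ring.
    move=> kj; split; [lra|lra|].
    rewrite (_ : (j%:R + 1) * al - j%:R * al = al); last by ring.
    apply: le_trans (kj _ _); [|lra|lra].
    have alE : 0 < al * E by rewrite mulr_gt0.
    lra.
  have K1K : (K.-1 < K)%N by rewrite prednK.
  apply: chain_cat (full _ K1K) _; apply: chain1.
  have KE : K%:R = K.-1%:R + 1 :> R by rewrite natr1 prednK.
  rewrite KE in K1 K2; have := kge ((K.-1%:R + 1) * al).
  have jal0 : 0 <= K.-1%:R * al by rewrite mulr_ge0// ltW.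
  rewrite (_ : (K.-1%:R + 1) * al - al = K.-1%:R * al); last by ring.
  move=> kj; split; [lra|lra|].
  apply: (@le_trans _ _ (al * E)); last first.
    apply: le_trans (kj _ _) _; [lra|lra|].
    apply: le_mass; [exact: measurable_segment|exact: measurable_segment|].
    by move=> x /andP[h1 h2]; apply/andP; split; lra.
  rewrite mulrC [al * E]mulrC.
  rewrite (_ : E * al = 2 * al * (E / 2)); last by field.
  by rewrite ler_pM2r ?divr_gt0//; lra.
apply: mass_eq0; first exact: measurableC.
rewrite kE; last exact: measurableC.
apply: big1 => i _; apply/eqP; rewrite eq_le mass_ge0 andbT.
rewrite (@le_trans _ _ (mass m (Tbg @^-1` (~` B))))//; last first.
  by rewrite Tbg_inv ?(eq0_mass mB0)//; exact: measurableC.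
rewrite [leLHS](_ : _ = mass m ((to_unit \o (fun x => N%:R * U (Tbg x) -
  C%:R * beta + i%:R * beta)) @^-1` (~` \bigcup_i D i)))//.
apply: le_mass.
- by apply: measurable_preimage => //; exact: measurableC.
- by apply: measurable_preimage => //; exact: measurableC.
- move=> x nD BT; apply: nD; exists i => //.
  by case: (projT2 (DP i)) => _ _ /(_ _ BT); rewrite addrA.
Qed.

Lemma singular_dirac (B : set X) : measurable B -> lam B = 0%E -> m (~` B) = 0%E ->
  m (~` [set unit0 R]) = 0%E.
Proof.
move=> mB B0 mB0; have m0 := singular_mean0 mB B0 mB0.
pose F n : set X := [set x | n.+1%:R^-1 <= U x].
have mF n : measurable (F n).
  rewrite (_ : F n = @unit_val R @^-1` [set` `[n.+1%:R^-1, +oo[]); last first.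
    by apply/seteqP; split=> x; rewrite /F/= in_itv/= andbT.
  by apply: measurable_unit_val_preimage; exact: measurable_itv.
rewrite (_ : ~` _ = \bigcup_n F n); last first.
  apply/seteqP; split=> [x x0|x [n _ Fx] xE].
    have xpos : 0 < U x.
      rewrite lt_neqAle unit_val_ge0 andbT; apply/eqP => xE; apply: x0.
      exact: unit_val_inj.
    exists (Num.truncn (U x)^-1) => //=; rewrite /F/= -[leRHS]invrK lef_pV2 ?posrE ?invr_gt0//.
    exact/ltW/truncnS_gt.
  move: Fx; rewrite /F/= xE leNgt => /negP; apply.
  by rewrite [ltLHS](_ : _ = 0) ?invr_gt0.
apply: measure_bigcup0 => // n; apply: mass_eq0 => //.
have n0 : 0 < n.+1%:R^-1 :> R by [].
have := @markov_mass _ _ _ m _ _ n0 bm_val (@unit_val_ge0 R).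
rewrite m0 pmulr_rle0// => h; apply/eqP; rewrite eq_le mass_ge0 andbT.
exact: h.
Qed.

End SingularPart.

(** * The Parry measure *)

Section GeometricallyBoundedSeries.
Context {R : realType}.
Implicit Types (b : R) (a : nat -> R).

Definition series_sum a : R := fine (\sum_(0 <= n <oo) (a n)%:E)%E.

Lemma series_sum_bounds b (h : R) a : 1 < b -> 0 <= h ->
  (forall n, 0 <= a n <= h * b ^- n) ->
  (\sum_(0 <= n <oo) (a n)%:E)%E = (series_sum a)%:E /\
  forall N, \sum_(n < N) a n <= series_sum a <=
    \sum_(n < N) a n + h * (b / (b - 1)) * b ^- N.
Proof.
move=> b1 h0 ab.
have b0 : 0 < b by exact: lt_trans b1.
have bb1 : 0 < b - 1 by rewrite subr_gt0.
have a0 n : 0 <= a n by case/andP: (ab n).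
(* The exact difference of powers, rather than [b ^- N] alone, is what lets the induction close. *)
have tail N k : \sum_(n < N + k) a n <=
    \sum_(n < N) a n + h * (b / (b - 1)) * (b ^- N - b ^- (N + k)).
  elim: k => [|k IHk]; first by rewrite addn0 subrr mulr0 addr0.
  rewrite addnS big_ord_recr/=.
  have /andP[_] := ab (N + k)%N; rewrite exprS invfM.
  have : h * (b / (b - 1)) * (b ^- (N + k) - b^-1 * b ^- (N + k)) = h * b ^- (N + k).
    by field; rewrite expf_neq0 ?gt_eqF.
  lra.
have sumle N M : \sum_(n < M) a n <= \sum_(n < N) a n + h * (b / (b - 1)) * b ^- N.
  have hb : 0 <= h * (b / (b - 1)) by rewrite mulr_ge0// divr_ge0// ltW.
  have bN i : 0 <= b ^- i by rewrite invr_ge0 exprn_ge0// ltW.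
  have [MN|/ltnW NM] := leqP M N.
    rewrite -(subnKC MN) big_split_ord/= -addrA lerDl addr_ge0 ?sumr_ge0//.
    by rewrite subnKC// mulr_ge0.
  have := tail N (M - N)%N; rewrite subnKC// => /le_trans; apply.
  by rewrite lerD2l ler_wpM2l// gerBl.
have ege0 n : (0 <= n)%N -> xpredT n -> (0 <= (a n)%:E)%E by move=> _ _; rewrite lee_fin.
have psumE N : (\sum_(0 <= n < N) (a n)%:E)%E = (\sum_(n < N) a n)%:E.
  by rewrite big_mkord sumEFin.
have lower N : ((\sum_(n < N) a n)%:E <= \sum_(0 <= n <oo) (a n)%:E)%E.
  by rewrite -psumE; exact: nneseries_lim_ge.
have upper N : (\sum_(0 <= n <oo) (a n)%:E <=
    (\sum_(n < N) a n + h * (b / (b - 1)) * b ^- N)%:E)%E.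
  apply: lime_le; first exact: is_cvg_nneseries.
  by apply: nearW => M; rewrite psumE lee_fin.
have sumE : (\sum_(0 <= n <oo) (a n)%:E)%E = (series_sum a)%:E.
  rewrite /series_sum fineK// ge0_fin_numE ?nneseries_ge0//.
  by apply: le_lt_trans (upper 0%N) _; rewrite ltry.
split=> // N; rewrite -!lee_fin -sumE; apply/andP; split; [exact: lower|exact: upper].
Qed.

Lemma eq_of_expr_bound b (K x y : R) : 1 < b ->
  (forall n, `|x - y| <= K * b ^- n) -> x = y.
Proof.
move=> b1 xyK; apply/eqP; rewrite -subr_eq0 -normr_le0 leNgt; apply/negP => xy0.
have K0 : 0 < K.
  by have := xyK 0%N; rewrite expr0 invr1 mulr1; exact: lt_le_trans.
have [n] := expr_inv_lt b1 (divr_gt0 xy0 K0).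
by rewrite ltr_pdivlMr// mulrC ltNge xyK.
Qed.

Lemma series_sum_eq b (h K v : R) a : 1 < b -> 0 <= h ->
  (forall n, 0 <= a n <= h * b ^- n) ->
  (forall N, `|v - \sum_(n < N) a n| <= K * b ^- N) -> series_sum a = v.
Proof.
move=> b1 h0 ab vK; have [_ sb] := series_sum_bounds b1 h0 ab.
apply: (@eq_of_expr_bound b (K + h * (b / (b - 1)))) => // N.
have := vK N; have /andP[] := sb N; rewrite !ler_norml => s1 s2 /andP[v1 v2].
have : 0 <= h * (b / (b - 1)) * b ^- N.
  by rewrite !mulr_ge0 ?invr_ge0 ?exprn_ge0 ?subr_ge0 ?(ltW b1)// ltW// (lt_trans _ b1).
by move=> ?; apply/andP; split; lra.
Qed.

End GeometricallyBoundedSeries.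

Section ParryMeasure.
Context {R : realType}.
Local Notation X := (unit_interval R).
Local Notation lam := (@unit_lebesgue R).
Variable b : R.
Hypothesis b1 : 1 < b.
Local Notation T := (@beta_map R b).

Let b0 : 0 < b. Proof. exact: lt_trans b1. Qed.

(* A sequence of reals rather than of points of [unit_interval], since it starts at [1]. *)
Definition orbit1 (n : nat) : R := iter n (fun s => fractional_part (b * s)) 1.

Lemma orbit1S n : orbit1 n.+1 = fractional_part (b * orbit1 n).
Proof. by []. Qed.

Lemma orbit1_itv n : 0 <= orbit1 n <= 1.
Proof.
case: n => [|n]; first by rewrite ler01 lexx.
by rewrite orbit1S fractional_part_ge0 ltW// fractional_part_lt1.
Qed.

Lemma orbit1_ge0 n : 0 <= orbit1 n. Proof. by case/andP: (orbit1_itv n). Qed.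

Lemma orbit1_lt1 n : orbit1 n.+1 < 1. Proof. exact: fractional_part_lt1. Qed.

Let expr_inv_ge0 n : 0 <= b ^- n.
Proof. by rewrite invr_ge0 exprn_ge0// ltW. Qed.

(** Parry's unnormalized density, summed as restrictions of [lam]: masses of sets are then explicit
    series and no integral is involved. *)
Definition parry_measure : set X -> \bar R :=
  mseries (fun n => mscale (NngNum (expr_inv_ge0 n))
                      (mrestr lam (measurable_segment 0 (orbit1 n)))) 0.

HB.instance Definition _ := Measure.on parry_measure.

Definition parry_term (A : set X) n : R := b ^- n * mass lam (A `&` segment 0 (orbit1 n)).

Let measurable_term (A : set X) n : measurable A -> measurable (A `&` segment 0 (orbit1 n)).
Proof. by move=> mA; apply: measurableI => //; exact: measurable_segment. Qed.

Lemma parry_term_bound (A : set X) n : measurable A ->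
  0 <= parry_term A n <= mass lam A * b ^- n.
Proof.
move=> mA; rewrite mulr_ge0 ?mass_ge0//= [leLHS]mulrC ler_wpM2r//.
by apply: le_mass => //; exact: measurable_term.
Qed.

Lemma parry_measureE (A : set X) : measurable A ->
  parry_measure A = (series_sum (parry_term A))%:E.
Proof.
move=> mA; have [<- _] := series_sum_bounds b1 (mass_ge0 lam A) (fun n => parry_term_bound n mA).
apply: eq_eseriesr => n _; rewrite /parry_term EFinM -massE//.
exact: measurable_term.
Qed.

Let parry_fin : fin_num_fun parry_measure.
Proof. by move=> A mA; rewrite parry_measureE. Qed.

HB.instance Definition _ := @Measure_isFinite.Build _ _ _ parry_measure parry_fin.

Lemma mass_parry (A : set X) : measurable A ->
  mass parry_measure A = series_sum (parry_term A).
Proof. by move=> mA; rewrite /mass /= parry_measureE. Qed.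

Lemma mass_parry_bounds (A : set X) N : measurable A ->
  \sum_(n < N) parry_term A n <= mass parry_measure A <=
    \sum_(n < N) parry_term A n + mass lam A * (b / (b - 1)) * b ^- N.
Proof.
move=> mA; rewrite mass_parry//.
by have [_ ->] := series_sum_bounds b1 (mass_ge0 lam A) (fun n => parry_term_bound n mA).
Qed.

(* The digit sums telescope: [sum b^-(n+1) * floor (b * o_n) = 1 - b^-N * o_N]. *)
Lemma sum_parry_term_preimage (A : set X) N : measurable A ->
  \sum_(n < N) parry_term (T @^-1` A) n =
  \sum_(n < N.+1) parry_term A n - b ^- N * orbit1 N * mass lam A.
Proof.
move=> mA; elim: N => [|N IHN].
  rewrite big_ord0 big_ord_recl big_ord0 /parry_term expr0 invr1 !mul1r addr0.
  by rewrite /= segment01 setIT ?mul1r subrr.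
rewrite big_ord_recr/= IHN [in RHS]big_ord_recr/= {2}/parry_term.
have /andP[u0 u1] := orbit1_itv N.
rewrite setIC (mass_transfer b0 u0 u1 mA) -orbit1S /parry_term.
rewrite [in X in _ = _ - X](_ : b ^- N.+1 * orbit1 N.+1 =
  b ^- N * orbit1 N - b ^- N.+1 * (Num.floor (b * orbit1 N))%:~R); last first.
  rewrite orbit1S /fractional_part mulrBr; congr (_ - _).
  by rewrite exprS invfM; field; rewrite expf_neq0 ?gt_eqF.
by rewrite exprS invfM; ring.
Qed.

Lemma parry_measure_invariant (A : set X) : measurable A ->
  mass parry_measure (T @^-1` A) = mass parry_measure A.
Proof.
move=> mA.
have mTA : measurable (T @^-1` A).
  by apply: measurable_preimage => //; exact: measurable_beta_map.
rewrite (mass_parry mA); apply/esym.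
(* The [1] bounds the two boundary terms of [sum_parry_term_preimage], of opposite sign and each at
   most [b ^- N]; the rest is the tail of the series for the preimage. *)
apply: (@series_sum_eq _ b _ (1 + b / (b - 1)) _ _ b1 (mass_ge0 lam A)) => [n|N].
  exact: parry_term_bound.
have /andP[t1 t2] := mass_parry_bounds N mTA.
rewrite sum_parry_term_preimage// big_ord_recr/= in t1 t2.
have /andP[s0 s1] := parry_term_bound N mA.
have q0 : 0 <= b ^- N := expr_inv_ge0 N.
have lam1 B : measurable B -> mass lam B <= 1.
  by move=> mB; rewrite -mass_lam_setT le_mass.
have := lam1 _ mA; have := mass_ge0 lam A; have := lam1 _ mTA.
move: s0 s1 t1 t2; set x := mass lam A; set y := mass lam (T @^-1` A); set K := b / (b - 1).
move=> s0 s1 t1 t2 y1 x0 x1.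
have K0 : 0 <= K by rewrite divr_ge0 ?subr_ge0 ?(ltW b0)// ltW.
have h1 : 0 <= b ^- N * orbit1 N * x <= b ^- N.
  rewrite !mulr_ge0 ?orbit1_ge0//= -mulrA ler_piMr// mulr_ile1 ?orbit1_ge0//.
  by case/andP: (orbit1_itv N).
have h2 : y * K * b ^- N <= K * b ^- N by rewrite -mulrA ler_piMl// mulr_ge0.
have h3 : x * b ^- N <= b ^- N by rewrite ler_piMl.
have h4 : 0 <= K * b ^- N by rewrite mulr_ge0.
move: h1 => /andP[h1 h1'].
by rewrite ler_norml; apply/andP; split; lra.
Qed.

Lemma parry_measure_ac (A : set X) : measurable A -> lam A = 0%E -> parry_measure A = 0%E.
Proof.
move=> mA A0; apply: mass_eq0 => //; apply/eqP; rewrite eq_le mass_ge0 andbT.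
have /andP[_] := mass_parry_bounds 0 mA.
by rewrite big_ord0 (eq0_mass A0) !mul0r addr0.
Qed.

Lemma mass_parry_gt0 : 0 < mass parry_measure setT.
Proof.
have /andP[+ _] := mass_parry_bounds 1 measurableT; apply: lt_le_trans.
by rewrite big_ord_recl big_ord0 /parry_term expr0 invr1 mul1r addr0 /orbit1 segment01
  setTI mass_lam_setT.
Qed.

Let parry_prob : probability X R := mnormalize parry_measure lam.

Let parry_probE A : measurable A ->
  parry_prob A = (mass parry_measure A / mass parry_measure setT)%:E.
Proof.
move=> mA; rewrite /parry_prob /= /mnormalize.
have := mass_parry_gt0; case: ifPn => [/orP[] /eqP h|_ _].
- by rewrite [mass _ _](congr1 fine h) ltxx.
- by rewrite [mass _ _](congr1 fine h) ltxx.
- by rewrite EFinM; congr (_ * _)%E; exact: massE.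
Qed.

Let parry_prob_invariant A : measurable A -> parry_prob (T @^-1` A) = parry_prob A.
Proof.
move=> mA; rewrite !parry_probE ?parry_measure_invariant//.
by apply: measurable_preimage => //; exact: measurable_beta_map.
Qed.

Let parry_prob_ac A : measurable A -> lam A = 0%E -> parry_prob A = 0%E.
Proof.
by move=> mA A0; rewrite parry_probE// (eq0_mass (parry_measure_ac mA A0)) mul0r.
Qed.

(** The normalized Parry measure is a witness, which is what makes [get] return a measure with the
    property. *)
Lemma renyi_parry_spec : is_renyi_parry b (renyi_parry b : probability X R).
Proof.
apply: getPex; exists parry_prob; split.
  exact: parry_prob_invariant.
by apply/null_content_dominatesP; exact: parry_prob_ac.
Qed.

Lemma invariant_ac_parry (m : {finite_measure set X -> \bar R}) :
  (forall A, measurable A -> mass m (T @^-1` A) = mass m A) ->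
  (forall A, measurable A -> lam A = 0%E -> m A = 0%E) ->
  forall A, measurable A ->
    mass m A = mass m setT / mass parry_measure setT * mass parry_measure A.
Proof.
move=> mT mac A mA; have p0 := mass_parry_gt0.
have r0 : 0 <= mass m setT / mass parry_measure setT by rewrite divr_ge0 ?mass_ge0.
pose m' : {finite_measure set X -> \bar R} := mscale (NngNum r0) parry_measure.
have m'E B : measurable B ->
    mass m' B = mass m setT / mass parry_measure setT * mass parry_measure B.
  by move=> mB; rewrite /mass/= /mscale/= parry_measureE.
rewrite -m'E//; congr fine; apply: (invariant_ac_unique b1 mT) => //.
- move=> B mB; rewrite !m'E ?parry_measure_invariant//.
  by apply: measurable_preimage => //; exact: measurable_beta_map.
- move=> B mB B0; apply: mass_eq0 => //.
  by rewrite m'E// (eq0_mass (parry_measure_ac mB B0)) mulr0.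
- by rewrite m'E// divfK// gt_eqF.
Qed.

Lemma renyi_parryE A : measurable A ->
  renyi_parry b A = (mass parry_measure A / mass parry_measure setT)%:E.
Proof.
move=> mA; have [nuT /null_content_dominatesP nuac] := renyi_parry_spec.
rewrite massE//; congr EFin; rewrite (@invariant_ac_parry (renyi_parry b))//.
- by rewrite /mass /= probability_setT/= mulrAC mul1r.
- by move=> B mB; exact: (congr1 fine (nuT _ mB)).
Qed.

End ParryMeasure.

(** * Jumps of the Parry density *)

Section WeightedIndicators.
Context {R : realType}.
Variable b : R.
Hypothesis b1 : 1 < b.
Implicit Types P Q D : nat -> bool.

Let b0 : 0 < b. Proof. exact: lt_trans b1. Qed.

(** For [P n] equal to [x < orbit1 b n] this is the Parry density on the right of [x], with
    [x <= orbit1 b n] the density on the left, and with equality the jump at [x]. *)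
Definition weight P : R := series_sum (fun n => b ^- n * (P n)%:R).

Let weight_term P n : 0 <= b ^- n * (P n)%:R <= 1 * b ^- n.
Proof.
have bn : 0 <= b ^- n by rewrite invr_ge0 exprn_ge0// ltW.
by rewrite mul1r; case: (P n); rewrite ?mulr1 ?mulr0 !lexx ?bn.
Qed.

Lemma weight_bounds P N : \sum_(n < N) b ^- n * (P n)%:R <= weight P <=
  \sum_(n < N) b ^- n * (P n)%:R + b / (b - 1) * b ^- N.
Proof.
by have [_ /(_ N)] := series_sum_bounds b1 ler01 (weight_term P); rewrite mul1r.
Qed.

Lemma weight_unique P K (v : R) :
  (forall N, `|v - \sum_(n < N) b ^- n * (P n)%:R| <= K * b ^- N) -> weight P = v.
Proof. exact: (series_sum_eq b1 ler01 (weight_term P)). Qed.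

Lemma weight_ge0 P : 0 <= weight P.
Proof. by have /andP[+ _] := weight_bounds P 0; rewrite big_ord0. Qed.

Let tail_ge0 N : 0 <= b / (b - 1) * b ^- N.
Proof.
by rewrite !mulr_ge0 ?invr_ge0 ?exprn_ge0 ?subr_ge0 ?(ltW b0) ?(ltW b1).
Qed.

Lemma weightD P Q D : (forall n, P n = Q n (+) D n) -> (forall n, ~~ (Q n && D n)) ->
  weight P = weight Q + weight D.
Proof.
move=> PQD QD; apply: (@weight_unique _ (b / (b - 1) + b / (b - 1))) => N.
have -> : \sum_(n < N) b ^- n * (P n)%:R =
    \sum_(n < N) b ^- n * (Q n)%:R + \sum_(n < N) b ^- n * (D n)%:R :> R.
  rewrite -big_split/=; apply: eq_bigr => n _; rewrite PQD -mulrDr; congr (_ * _).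
  by have := QD n; case: (Q n); case: (D n) => //=; rewrite ?addr0 ?add0r.
have /andP[q0 q1] := weight_bounds Q N; have /andP[d0 d1] := weight_bounds D N.
by have := tail_ge0 N; rewrite ler_norml => ?; apply/andP; split; lra.
Qed.

Lemma weight_recl P : weight P = (P 0%N)%:R + b^-1 * weight (fun n => P n.+1).
Proof.
apply: (@weight_unique _ (1 + b / (b - 1))) => -[|N].
  rewrite big_ord0 subr0 expr0 invr1 mulr1.
  have /andP[w0 w1] := weight_bounds (fun n => P n.+1) 0.
  rewrite big_ord0 add0r expr0 invr1 mulr1 in w1; rewrite big_ord0 in w0.
  have bi : 0 <= b^-1 <= 1 by rewrite invr_ge0 (ltW b0) invf_le1// ltW.
  rewrite ger0_norm; last by rewrite addr_ge0// mulr_ge0//; case/andP: bi.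
  apply: lerD; first by case: (P 0%N).
  by apply: le_trans w1; rewrite ler_piMl//; case/andP: bi.
rewrite big_ord_recl expr0 invr1 mul1r opprD addrACA subrr add0r.
rewrite (eq_bigr (fun i : 'I_N => b^-1 * (b ^- i * (P i.+1)%:R))); last first.
  by move=> i _; rewrite lift0 exprS invfM mulrA.
rewrite -mulr_sumr -mulrBr normrM gtr0_norm ?invr_gt0// exprS invfM mulrCA.
rewrite ler_pM2l ?invr_gt0// mulrDl mul1r.
have /andP[w0 w1] := weight_bounds (fun n => P n.+1) N.
have := tail_ge0 N; have : 0 <= b ^- N by rewrite invr_ge0 exprn_ge0// ltW.
by rewrite ler_norml => ? ?; apply/andP; split; lra.
Qed.

Lemma weight_false P : (forall n, ~~ P n) -> weight P = 0.
Proof.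
move=> P0; apply: (@weight_unique _ 0) => N; rewrite big1 ?subrr ?normr0 ?mul0r// => n _.
by rewrite (negPf (P0 n)) mulr0.
Qed.

Lemma weight_gt0 P : 0 < weight P -> exists n, P n.
Proof.
move=> P0; apply: contrapT => nP; move: P0; rewrite weight_false ?ltxx// => n.
by apply/negP => Pn; apply: nP; exists n.
Qed.

Lemma weight_single P n : (forall k, P k = (k == n)) -> weight P = b ^- n.
Proof.
elim: n P => [|n IHn] P Pn; rewrite weight_recl Pn.
  by rewrite weight_false ?mulr0 ?addr0 ?expr0 ?invr1// => k; rewrite Pn.
by rewrite (IHn (fun k => P k.+1)) ?add0r ?exprS ?invfM// => k; rewrite Pn.
Qed.

Lemma le_weight P Q : (forall n, P n -> Q n) -> weight P <= weight Q.
Proof.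
move=> PQ; rewrite (@weightD Q P (fun n => Q n && ~~ P n)).
- by rewrite lerDl weight_ge0.
- by move=> n; have := PQ n; case: (P n); case: (Q n) => // /(_ isT).
- by move=> n; case: (P n); rewrite ?andbF.
Qed.

Lemma weight_ge P n : P n -> b ^- n <= weight P.
Proof.
move=> Pn; rewrite -(@weight_single (pred1 n))//; apply: le_weight => k /eqP ->.
exact: Pn.
Qed.

Lemma weight_true P : (forall n, P n) -> weight P = b / (b - 1).
Proof.
move=> PT; have e : weight P = 1 + b^-1 * weight P.
  rewrite {1}weight_recl PT; congr (_ + _ * weight _).
  by apply/funext => n; rewrite !PT.
have : (b - 1) * weight P = b.
  rewrite [in LHS]e mulrDr mulr1 mulrA mulrBl mulfV ?gt_eqF// mul1r.
  by move: e; lra.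
have bm1 : b - 1 != 0 by rewrite subr_eq0 gt_eqF.
by move=> h; rewrite -[LHS](mulKf bm1) h mulrC.
Qed.

Lemma weight_le P : weight P <= b / (b - 1).
Proof. by rewrite -(@weight_true xpredT)//; exact: le_weight. Qed.

End WeightedIndicators.

Section LocalDensity.
Context {R : realType}.
Local Notation X := (unit_interval R).
Local Notation lam := (@unit_lebesgue R).

Section OneBase.
Variable b : R.
Hypothesis b1 : 1 < b.
Let b0 : 0 < b. Proof. exact: lt_trans b1. Qed.

(** The first [N] terms agree exactly, so only two geometric tails are compared. *)
Let parry_local (A : R -> set X) (P : nat -> bool) N (h : R) :
  0 < h -> measurable (A h) -> mass lam (A h) = h ->
  (forall n, (n < N)%N ->
    mass lam (A h `&` segment 0 (orbit1 b n)) = h * (P n)%:R) ->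
  `|mass (parry_measure b1) (A h) / h - weight b P| <= b / (b - 1) * b ^- N.
Proof.
move=> h0 mA mh hP; have /andP[p0 p1] := mass_parry_bounds b1 N mA.
have sE : \sum_(n < N) parry_term b (A h) n = h * \sum_(n < N) b ^- n * (P n)%:R.
  rewrite mulr_sumr; apply: eq_bigr => n _.
  by rewrite /parry_term hP// mulrCA.
rewrite sE mh -mulrA -mulrDr in p1; rewrite sE in p0.
have /andP[w0 w1] := weight_bounds b1 P N.
rewrite ler_norml; apply/andP; split.
  have : \sum_(n < N) b ^- n * (P n)%:R <= mass (parry_measure b1) (A h) / h.
    by rewrite ler_pdivlMr// mulrC.
  lra.
have : mass (parry_measure b1) (A h) / h <=
    \sum_(n < N) b ^- n * (P n)%:R + b / (b - 1) * b ^- N.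
  by rewrite ler_pdivrMr// mulrC.
lra.
Qed.

(** [h0] is chosen so that none of the first [N] orbit points lies strictly between [x] and
    [x + h0]. *)
Lemma parry_right_density (x : R) N : 0 <= x -> x < 1 -> exists h0 : R, 0 < h0 /\
  forall h, 0 < h -> h <= h0 ->
  `|mass (parry_measure b1) (segment x (x + h)) / h - weight b (fun n => x < orbit1 b n)|
    <= b / (b - 1) * b ^- N.
Proof.
move=> x0 x1.
have [h0 [h00 h01 hN]] : exists h0 : R, [/\ 0 < h0, x + h0 <= 1 &
    forall n, (n < N)%N -> x < orbit1 b n -> x + h0 <= orbit1 b n].
  elim: N => [|N [h0 [h00 h01 hN]]]; first by exists (1 - x); split=> //; lra.
  have [xo|ox] := ltP x (orbit1 b N); last first.
    exists h0; split=> // n; rewrite ltnS leq_eqVlt => /orP[/eqP ->|]; last exact: hN.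
    by rewrite ltNge ox.
  exists (Num.min h0 (orbit1 b N - x)); have m1 : Num.min h0 (orbit1 b N - x) <= h0.
    by rewrite ge_min lexx.
  have m2 : Num.min h0 (orbit1 b N - x) <= orbit1 b N - x by rewrite ge_min lexx orbT.
  split; [by rewrite lt_min h00 subr_gt0|lra|].
  move=> n; rewrite ltnS leq_eqVlt => /orP[/eqP -> _|nN xn]; first lra.
  by have := hN _ nN xn; lra.
exists h0; split=> // h hpos hh0.
apply: (@parry_local (fun h => segment x (x + h))) => //.
- exact: measurable_segment.
- by rewrite mass_segment//; [rewrite addrAC subrr add0r|lra|lra].
- move=> n nN; have [xo|ox] := ltP x (orbit1 b n).
    have := hN _ nN xo => xho.
    rewrite mulr1 (_ : _ `&` _ = segment x (x + h)).
      by rewrite mass_segment//; [rewrite addrAC subrr add0r|lra|lra].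
    by apply/setIidPl => y /andP[y0 y1]; apply/andP; split; lra.
  rewrite mulr0 (_ : _ `&` _ = set0) ?mass_set0//.
  apply/seteqP; split=> // y [/andP[y0 y1] /andP[z0 z1]].
  by have := lt_le_trans (lt_le_trans z1 ox) y0; rewrite ltxx.
Qed.

(** An orbit point equal to [x] still counts on the left of [x]; this is the only difference from
    the right limit. *)
Lemma parry_left_density (x : R) N : 0 < x -> x <= 1 -> exists h0 : R, 0 < h0 /\
  forall h, 0 < h -> h <= h0 ->
  `|mass (parry_measure b1) (segment (x - h) x) / h - weight b (fun n => x <= orbit1 b n)|
    <= b / (b - 1) * b ^- N.
Proof.
move=> x0 x1.
have [h0 [h00 h01 hN]] : exists h0 : R, [/\ 0 < h0, h0 <= x &
    forall n, (n < N)%N -> orbit1 b n < x -> orbit1 b n <= x - h0].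
  elim: N => [|N [h0 [h00 h01 hN]]]; first by exists x; split=> //; lra.
  have [xo|ox] := leP x (orbit1 b N).
    exists h0; split=> // n; rewrite ltnS leq_eqVlt => /orP[/eqP ->|]; last exact: hN.
    by rewrite ltNge xo.
  exists (Num.min h0 (x - orbit1 b N)); have m1 : Num.min h0 (x - orbit1 b N) <= h0.
    by rewrite ge_min lexx.
  have m2 : Num.min h0 (x - orbit1 b N) <= x - orbit1 b N by rewrite ge_min lexx orbT.
  split; [by rewrite lt_min h00 subr_gt0|lra|].
  move=> n; rewrite ltnS leq_eqVlt => /orP[/eqP -> _|nN xn]; first lra.
  by have := hN _ nN xn; lra.
exists h0; split=> // h hpos hh0.
apply: (@parry_local (fun h => segment (x - h) x)) => //.
- exact: measurable_segment.
- by rewrite mass_segment//; [rewrite opprB addrC subrK|lra|lra].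
- move=> n nN; have [xo|ox] := leP x (orbit1 b n).
    rewrite mulr1 (_ : _ `&` _ = segment (x - h) x).
      by rewrite mass_segment//; [rewrite opprB addrC subrK|lra|lra].
    by apply/setIidPl => y /andP[y0 y1]; apply/andP; split; lra.
  have := hN _ nN ox => xho.
  rewrite mulr0 (_ : _ `&` _ = set0) ?mass_set0//.
  apply/seteqP; split=> // y [/andP[y0 y1] /andP[z0 z1]].
  by have := lt_le_trans (lt_le_trans z1 (le_trans xho (lerB (lexx x) hh0))) y0; rewrite ltxx.
Qed.

End OneBase.

Section TwoBases.
Variables beta gamma : R.
Hypotheses (beta1 : 1 < beta) (gamma1 : 1 < gamma) (ltbg : beta < gamma).
Variables C D : R.
Hypotheses (C0 : 0 < C) (D0 : 0 < D).
Hypothesis CD : forall A : set X, measurable A ->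
  C * mass (parry_measure beta1) A = D * mass (parry_measure gamma1) A.

Let expr_inv_le N : gamma ^- N <= beta ^- N.
Proof.
have b0 : 0 < beta := lt_trans ltr01 beta1; have g0 : 0 < gamma := lt_trans ltr01 gamma1.
by rewrite lef_pV2 ?posrE ?exprn_gt0// lerXn2r ?nnegrE ?(ltW b0) ?(ltW g0)// ltW.
Qed.

Let weight_proportional (A : R -> set X) (P Q : nat -> bool) :
  (forall h, measurable (A h)) ->
  (forall N, exists h0 : R, 0 < h0 /\ forall h, 0 < h -> h <= h0 ->
    `|mass (parry_measure beta1) (A h) / h - weight beta P| <= beta / (beta - 1) * beta ^- N) ->
  (forall N, exists h0 : R, 0 < h0 /\ forall h, 0 < h -> h <= h0 ->
    `|mass (parry_measure gamma1) (A h) / h - weight gamma Q| <=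
      gamma / (gamma - 1) * gamma ^- N) ->
  C * weight beta P = D * weight gamma Q.
Proof.
move=> mA HP HQ.
apply: (@eq_of_expr_bound _ beta (C * (beta / (beta - 1)) + D * (gamma / (gamma - 1)))) => // N.
have [h1 [h10 {}HP]] := HP N; have [h2 [h20 {}HQ]] := HQ N.
have h0 : 0 < Num.min h1 h2 by rewrite lt_min h10.
have := HP _ h0; have := HQ _ h0; rewrite !ge_min !lexx orbT => /(_ isT) + /(_ isT).
have := CD (mA (Num.min h1 h2)); move: (Num.min _ _) h0 => h h0 CDh Q1 P1.
have {}CDh : C * (mass (parry_measure beta1) (A h) / h) =
    D * (mass (parry_measure gamma1) (A h) / h) by rewrite !mulrA CDh.
have Q2 : D * `|mass (parry_measure gamma1) (A h) / h - weight gamma Q| <=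
    D * (gamma / (gamma - 1) * beta ^- N).
  rewrite ler_pM2l//; apply: (le_trans Q1); apply: ler_wpM2l; last exact: expr_inv_le.
  apply: divr_ge0; first exact/ltW/(lt_trans ltr01).
  by rewrite subr_ge0 ltW.
have P2 : C * `|mass (parry_measure beta1) (A h) / h - weight beta P| <=
    C * (beta / (beta - 1) * beta ^- N) by rewrite ler_pM2l.
rewrite (_ : C * weight beta P - _ =
  D * (mass (parry_measure gamma1) (A h) / h - weight gamma Q) -
  C * (mass (parry_measure beta1) (A h) / h - weight beta P)); last first.
  by rewrite !mulrBr CDh; ring.
apply: le_trans (ler_normB _ _) _; rewrite !normrM (gtr0_norm C0) (gtr0_norm D0).
rewrite addrC mulrDl -!mulrA; apply: lerD.
  by move: P2; rewrite -!mulrA.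
by move: Q2; rewrite -!mulrA.
Qed.

Lemma weight_lt_proportional (x : R) : 0 <= x -> x < 1 ->
  C * weight beta (fun n => x < orbit1 beta n) = D * weight gamma (fun n => x < orbit1 gamma n).
Proof.
move=> x0 x1; apply: (@weight_proportional (fun h => segment x (x + h))).
- by move=> h; exact: measurable_segment.
- by move=> N; exact: parry_right_density.
- by move=> N; exact: parry_right_density.
Qed.

Lemma weight_le_proportional (x : R) : 0 < x -> x <= 1 ->
  C * weight beta (fun n => x <= orbit1 beta n) = D * weight gamma (fun n => x <= orbit1 gamma n).
Proof.
move=> x0 x1; apply: (@weight_proportional (fun h => segment (x - h) x)).
- by move=> h; exact: measurable_segment.
- by move=> N; exact: parry_left_density.
- by move=> N; exact: parry_left_density.
Qed.

(** Just below [1] only the starting point of each orbit counts, so both densities are [1] there. *)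
Let constants_eq : C = D.
Proof.
have w1 b : 1 < b -> weight b (fun n => 1 <= orbit1 b n) = 1.
  move=> b1; rewrite (@weight_single _ _ b1 _ 0) ?expr0 ?invr1// => -[|k].
    by rewrite /orbit1 lexx.
  by rewrite leNgt orbit1_lt1.
by have := weight_le_proportional ltr01 (lexx 1); rewrite !w1// !mulr1.
Qed.

Lemma total_weight_eq :
  weight beta (fun n => 0 < orbit1 beta n) = weight gamma (fun n => 0 < orbit1 gamma n).
Proof.
have := weight_lt_proportional (lexx 0) ltr01; rewrite constants_eq.
by apply: mulfI; rewrite gt_eqF.
Qed.

Lemma jump_eq (x : R) : 0 < x -> x < 1 ->
  weight beta (fun n => orbit1 beta n == x) = weight gamma (fun n => orbit1 gamma n == x).
Proof.
move=> x0 x1.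
have split_le b : 1 < b -> weight b (fun n => x <= orbit1 b n) =
    weight b (fun n => orbit1 b n == x) + weight b (fun n => x < orbit1 b n).
  move=> b1; apply: weightD => // n.
    by rewrite le_eqVlt eq_sym; case: eqP => //= ->; rewrite ltxx.
  by case: eqP => //= ->; rewrite ltxx.
have := weight_le_proportional x0 (ltW x1); have := weight_lt_proportional (ltW x0) x1.
rewrite constants_eq => /(mulfI (negbT (gt_eqF D0))) e /(mulfI (negbT (gt_eqF D0))).
by rewrite !split_le// e => /addIr.
Qed.

End TwoBases.

End LocalDensity.

Lemma absz_itv (s t : int) : 0 < t -> t <= s -> (1 <= `|t| <= `|s|)%N.
Proof. by lia. Qed.

(** * Two bases with the same jumps *)

Section JumpComparison.
Context {R : realType}.
Variables beta gamma : R.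
Hypotheses (beta1 : 1 < beta) (gamma1 : 1 < gamma) (ltbg : beta < gamma).
Hypothesis total_eq :
  weight beta (fun n => 0 < orbit1 beta n) = weight gamma (fun n => 0 < orbit1 gamma n).
Hypothesis jumps_eq : forall x : R, 0 < x -> x < 1 ->
  weight beta (fun n => orbit1 beta n == x) = weight gamma (fun n => orbit1 gamma n == x).
Hypothesis not_integers : (orbit1 beta 1 != 0) || (orbit1 gamma 1 != 0).
Local Notation o_ := (orbit1 beta).
Local Notation p_ := (orbit1 gamma).

Let beta0 : 0 < beta. Proof. exact: lt_trans beta1. Qed.
Let gamma0 : 0 < gamma. Proof. exact: lt_trans gamma1. Qed.

Let orbit_eq0_stable (b : R) n k : orbit1 b n = 0 -> orbit1 b (n + k) = 0.
Proof.
by move=> bn0; elim: k => [|k IHk]; rewrite ?addn0// addnS orbit1S IHk mulr0 fractional_part0.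
Qed.

Let orbit_shift (b : R) n m k : orbit1 b n = orbit1 b m -> orbit1 b (n + k) = orbit1 b (m + k).
Proof. by move=> nm; elim: k => [|k IHk]; rewrite ?addn0// !addnS !orbit1S IHk. Qed.

Let orbit_gt0 (b : R) n : orbit1 b n != 0 -> 0 < orbit1 b n.
Proof. by move=> h; rewrite lt_neqAle eq_sym h orbit1_ge0. Qed.

Let betaV_le i j : (i <= j)%N -> beta ^- j <= beta ^- i.
Proof. by move=> ij; rewrite lef_pV2 ?posrE ?exprn_gt0// ler_eXn2l. Qed.

(** Otherwise the total weight in base [beta] is the full [beta / (beta - 1)], above anything
    possible in the larger base [gamma]. *)
Let beta_hits_zero : exists n, o_ n == 0.
Proof.
apply: contrapT => nz.
have : weight beta (fun n => 0 < o_ n) = beta / (beta - 1).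
  apply: weight_true => // n; apply: orbit_gt0; apply/negP => h.
  by apply: nz; exists n.
rewrite total_eq => h; have := weight_le gamma1 (fun n => 0 < p_ n); rewrite h.
rewrite ler_pdivrMr ?subr_gt0// mulrAC ler_pdivlMr ?subr_gt0//.
by move: ltbg; lra.
Qed.

Let n : nat := (ex_minn beta_hits_zero).-1.

Let o_n1 : o_ n.+1 = 0.
Proof.
rewrite /n; case: ex_minnP => -[|k] /= /eqP// /eqP.
by rewrite /orbit1/= oner_eq0.
Qed.

Let o_neq0 i : (i <= n)%N -> o_ i != 0.
Proof.
rewrite /n; case: ex_minnP => k k0 kmin ik; apply/negP => /kmin.
have : k != 0%N by apply: contraTneq k0 => ->; rewrite /orbit1/= oner_eq0.
by lia.
Qed.

Let o_eq0 i : (n < i)%N -> o_ i = 0.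
Proof. by move=> ni; rewrite -(subnKC ni) orbit_eq0_stable. Qed.

Let o_inj i j : (i <= n)%N -> (j <= n)%N -> o_ i = o_ j -> i = j.
Proof.
wlog ij : i j / (i < j)%N.
  by move=> H ni nj oij; case: (ltngtP i j) => // h; [|apply/esym]; apply: H.
move=> ni nj /(@orbit_shift _ _ _ (n.+1 - j)); rewrite (subnKC (leqW nj)) o_n1 => h.
have : (i + (n.+1 - j) <= n)%N by lia.
by move=> /o_neq0; rewrite h eqxx.
Qed.

Let o_lt1 i : (0 < i)%N -> o_ i < 1.
Proof. by case: i => // i _; exact: orbit1_lt1. Qed.

Let p_lt1 i : (0 < i)%N -> p_ i < 1.
Proof. by case: i => // i _; exact: orbit1_lt1. Qed.

Let jump_beta i : (0 < i)%N -> (i <= n)%N -> weight beta (fun k => o_ k == o_ i) = beta ^- i.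
Proof.
move=> i0 ni; apply: weight_single => // k; apply/eqP/eqP => [|->//].
have [nk|kn] := ltnP n k; last exact: o_inj.
by rewrite o_eq0// => /esym h; move: (o_neq0 ni); rewrite h eqxx.
Qed.

Let jump_gamma i : (0 < i)%N -> (i <= n)%N -> weight gamma (fun k => p_ k == o_ i) = beta ^- i.
Proof.
move=> i0 ni; rewrite -jumps_eq ?jump_beta//; first exact/orbit_gt0/o_neq0.
exact: o_lt1.
Qed.

Let p_in_o i : (0 < i)%N -> p_ i != 0 -> exists2 j, (0 < j <= n)%N & p_ i = o_ j.
Proof.
move=> i0 pi0.
have : 0 < weight beta (fun k => o_ k == p_ i).
  rewrite jumps_eq ?orbit_gt0 ?p_lt1//.
  apply: lt_le_trans (weight_ge gamma1 (n := i) _); last exact: eqxx.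
  by rewrite invr_gt0 exprn_gt0.
move=> /(weight_gt0 beta1)[j /eqP oj]; exists j => //.
have j0 : (0 < j)%N.
  case: j oj => // oj; have := p_lt1 i0.
  by rewrite -oj /orbit1/= ltxx.
by rewrite j0 leqNgt; apply/negP => /o_eq0 h; move: pi0; rewrite -oj h eqxx.
Qed.

Let o_in_p j : (0 < j <= n)%N -> exists2 i, (0 < i)%N & p_ i = o_ j.
Proof.
move=> /andP[j0 jn].
have : 0 < weight gamma (fun k => p_ k == o_ j).
  by rewrite jump_gamma// invr_gt0 exprn_gt0.
move=> /(weight_gt0 gamma1)[[|i] /eqP pi]; last by exists i.+1.
by have := o_lt1 j0; rewrite -pi /orbit1/= ltxx.
Qed.

(** The geometric sum of [beta ^- k] over [k <= n], in a form whose leading [1] cancels against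
    [gamma / (gamma - 1) = 1 + 1 / (gamma - 1)]. *)
Let total_beta : weight beta (fun k => 0 < o_ k) = 1 + (1 - beta ^- n) / (beta - 1).
Proof.
apply: (@weight_unique _ _ beta1 _ (beta / (beta - 1))) => N.
have bm1 : beta - 1 != 0 by rewrite subr_eq0 gt_eqF.
have geo M : (M <= n.+1)%N -> \sum_(k < M) beta ^- k * (0 < o_ k)%R%:R =
    beta / (beta - 1) * (1 - beta ^- M).
  elim: M => [|M IHM] Mn; first by rewrite big_ord0 expr0 invr1 subrr mulr0.
  rewrite big_ord_recr/= (IHM (ltnW Mn)) (orbit_gt0 (o_neq0 Mn)) mulr1 exprS invfM.
  by field; rewrite bm1 expf_neq0// gt_eqF.
have tot : 1 + (1 - beta ^- n) / (beta - 1) = beta / (beta - 1) * (1 - beta ^- n.+1).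
  by rewrite exprS invfM; field; rewrite bm1 expf_neq0// gt_eqF.
have [nN|Nn] := leqP n.+1 N.
  rewrite -(subnKC nN) big_split_ord/= geo//.
  rewrite [\sum_(i < N - n.+1) _]big1 ?addr0; last first.
    by move=> i _; rewrite -orbit1S -addSn (o_eq0 (leq_addr _ _)) ltxx mulr0.
  rewrite tot subrr normr0 mulr_ge0 ?invr_ge0 ?exprn_ge0 ?divr_ge0 ?subr_ge0 ?(ltW beta0)//.
  exact: ltW.
rewrite geo ?(ltnW Nn)// tot -mulrBr normrM ger0_norm; last first.
  by rewrite divr_ge0 ?subr_ge0 ?(ltW beta0)// ltW.
rewrite ler_wpM2l ?divr_ge0 ?subr_ge0 ?(ltW beta0) ?(ltW beta1)//.
rewrite (_ : 1 - beta ^- n.+1 - (1 - beta ^- N) = beta ^- N - beta ^- n.+1); last by ring.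
rewrite ger0_norm ?subr_ge0 ?gerBl ?invr_ge0 ?exprn_ge0 ?(ltW beta0)//.
exact/betaV_le/ltnW.
Qed.

(** With [n = 0] base [beta] has no jump inside the interval, while [not_integers] makes [p_ 1] a
    jump in base [gamma]. *)
Let n_gt0 : (0 < n)%N.
Proof.
rewrite lt0n; apply/negP => /eqP n0; move: not_integers.
have := o_n1; rewrite n0 => -> ; rewrite eqxx/= => p1.
by have [j] := @p_in_o 1 isT p1; rewrite n0; case: j.
Qed.

Let p1_neq0 : p_ 1 != 0.
Proof.
apply/negP => /eqP p10; have [|[|i] // _] := @o_in_p 1 _; first exact: n_gt0.
rewrite -add1n orbit_eq0_stable// => h.
by have := o_neq0 n_gt0; rewrite -h eqxx.
Qed.

Let o_le i : o_ i.+1 <= beta ^+ i.+1 - beta ^+ i.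
Proof.
elim: i => [|i IHi].
  rewrite expr1 expr0 orbit1S /orbit1/= mulr1 /fractional_part lerB//.
  by rewrite -[1]/(1%:~R) ler_int floor_ge_int ltW.
rewrite orbit1S /fractional_part (@le_trans _ _ (beta * o_ i.+1))//.
  by rewrite gerBl ler0z floor_ge0 mulr_ge0 ?orbit1_ge0// ltW.
by rewrite exprS [beta ^+ i.+1 as X in _ - X]exprS -mulrBr ler_pM2l.
Qed.

(** As the orbit vanishes at [n + 1], the number [beta * o_ n] is a positive integer, hence at least
    [1]; [o_le] bounds it from above. *)
Let last_digit : 1 <= beta ^+ n.+1 - beta ^+ n.
Proof.
have nE : n.-1.+1 = n by rewrite prednK.
have h := o_le n.-1; rewrite nE -(ler_pM2l beta0) [leRHS]mulrBr -2!exprS nE in h.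
apply: (le_trans _ h); have := floor_fractional_part (beta * o_ n).
rewrite -orbit1S o_n1 addr0 => fE.
have : 0 < beta * o_ n by rewrite mulr_gt0// orbit_gt0// o_neq0.
by rewrite {1 2}fE ltr0z -[1]/(1%:~R) ler_int.
Qed.

(** Without a return the jump at [p_ 1] is [gamma^-1], so [gamma = beta ^+ j] with [2 <= j <= n].
    Then [gamma >= beta^2], and comparing total weights gives [beta^(n+1) <= beta + 1]; with
    [last_digit] this forces [beta^n <= beta], against [n >= 2]. *)
Let no_return : (forall i, (1 < i)%N -> p_ i != p_ 1) -> False.
Proof.
move=> nr; have [j /andP[j0 jn] pj] := @p_in_o 1 isT p1_neq0.
have := jump_gamma j0 jn; rewrite -pj (@weight_single _ _ gamma1 _ 1); last first.
  move=> [|[|k]]; rewrite ?eqxx//; last exact/negbTE/nr.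
  by apply/negbTE; rewrite /orbit1/= eq_sym lt_eqF// -[X in X < _]/(p_ 1) p_lt1.
rewrite expr1 => /invr_inj gE.
have j2 : (1 < j)%N.
  by rewrite ltnNge; apply/negP => j1; move: ltbg; rewrite gE (@anti_leq j 1) ?j1// expr1 ltxx.
have n2 : (1 < n)%N := leq_trans j2 jn.
have bb : beta ^+ 2 <= gamma by rewrite gE ler_eXn2l.
have := weight_le gamma1 (fun n => 0 < p_ n); rewrite -total_eq total_beta.
have [B0 g10] : 0 < beta - 1 /\ 0 < gamma - 1 by rewrite !subr_gt0.
rewrite (_ : gamma / (gamma - 1) = 1 + (gamma - 1)^-1); last by field; rewrite gt_eqF.
rewrite lerD2l ler_pdivrMr// => h.
have h2 : (gamma - 1)^-1 * (beta - 1) <= (beta + 1)^-1.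
  have bp : 0 < beta + 1 by rewrite addr_gt0.
  rewrite mulrC ler_pdivrMr// mulrC ler_pdivlMr//.
  by move: bb; rewrite expr2; lra.
have P0 : 0 < beta ^+ n by rewrite exprn_gt0.
have := le_trans h h2; rewrite -(ler_pM2r P0) mulrBl mul1r mulVf ?gt_eqF//.
rewrite mulrC ler_pdivlMr ?addr_gt0// => h3.
have := last_digit; rewrite exprS => h4.
have : beta ^+ n <= beta by move: h3 h4; lra.
by rewrite -[leRHS]expr1 ler_eXn2l// leqNgt n2.
Qed.

Let returns : exists2 r, (0 < r)%N & p_ r.+1 = p_ 1.
Proof.
apply: contrapT => h; apply: no_return => -[|[|i]]// _; apply/negP => /eqP pi.
by apply: h; exists i.+1.
Qed.

Let p_periodic r : p_ r.+1 = p_ 1 -> forall k m, (0 < k)%N -> p_ (k + m * r) = p_ k.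
Proof.
move=> rE k m k0; elim: m => [|m IHm]; first by rewrite mul0n addn0.
rewrite -[RHS]IHm mulSn addnA; apply: orbit_shift.
have := @orbit_shift _ _ _ k.-1 rE; rewrite add1n prednK// => <-.
by congr p_; lia.
Qed.

(** Zero is absorbing, whereas the orbit keeps coming back to the nonzero point [p_ 1]. *)
Let p_neq0 i : p_ i != 0.
Proof.
case: i => [|i]; first by rewrite /orbit1/= oner_eq0.
have [r r0 rE] := returns; apply/negP => /eqP pi.
have := p_periodic rE i.+1 (isT : (0 < 1)%N).
have le : (i.+1 <= 1 + i.+1 * r)%N by rewrite mulSn; nia.
rewrite -(subnKC le) orbit_eq0_stable// => h.
by have := p1_neq0; rewrite -h eqxx.
Qed.

(** From index [1] on the orbit is a cycle, where the map is injective; so the visits to [p_ m.+2]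
    are those to [p_ m.+1] delayed by one step. The hypothesis excludes an additional visit coming
    from the start [1]. *)
Let jump_shift m : p_ m.+2 != p_ 1 ->
  weight gamma (fun k => p_ k == p_ m.+2) = gamma^-1 * weight gamma (fun k => p_ k == p_ m.+1).
Proof.
move=> m1; rewrite (weight_recl gamma1).
have -> : (p_ 0 == p_ m.+2) = false.
  by apply/negbTE; rewrite eq_sym lt_eqF// -[X in _ < X]/1 p_lt1.
rewrite add0r; congr (_ * weight _ _); apply/funext => -[|k].
  have -> : (p_ 0 == p_ m.+1) = false.
    by apply/negbTE; rewrite eq_sym lt_eqF// -[X in _ < X]/1 p_lt1.
  by apply/negbTE; rewrite eq_sym.
have [r r0 rE] := returns; apply/eqP/eqP => [h|]; last first.
  by move=> h; rewrite !(orbit1S _ _.+1) h.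
(* One step of the map is undone by going [r - 1] further steps around the cycle. *)
have back i : p_ (i.+2 + r.-1) = p_ i.+1.
  by rewrite -(p_periodic rE 1 (isT : (0 < i.+1)%N)) mul1n -[in RHS](prednK r0) addnS.
by rewrite -back (orbit_shift _ h) back.
Qed.

(** If [o_ j] differs from [p_ 1], [jump_shift] gives some [i >= 1] with
    [beta ^- i = gamma * beta ^- j]; as [gamma > beta], this means [i < j - 1], impossible for
    [j = 1] and [j = 2]. So [o_ 1] is [p_ 1], and a nonzero [o_ 2] would coincide with it too. *)
Let n_eq1 : p_ 1 = o_ 1 /\ n = 1%N.
Proof.
have pred_jump j m : (0 < j <= n)%N -> p_ m.+2 = o_ j -> o_ j != p_ 1 ->
    exists2 i, (0 < i)%N & beta ^- i = gamma * beta ^- j.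
  move=> /andP[j0 jn] pm pj; have := @jump_shift m; rewrite pm => /(_ pj).
  have [i /andP[i0 ni] ->] := @p_in_o m.+1 isT (p_neq0 _).
  rewrite !jump_gamma// => e; exists i => //.
  by rewrite e mulrA mulfV ?mul1r// gt_eqF.
have no_jump j : beta ^- j != gamma * beta ^- j.+1.
  have q0 : beta ^- j.+1 != 0 by rewrite invr_eq0 expf_neq0// gt_eqF.
  rewrite (_ : beta ^- j = beta * beta ^- j.+1); last first.
    by rewrite exprS invfM mulrA mulfV ?mul1r// gt_eqF.
  by rewrite (inj_eq (mulIf q0)) lt_eqF.
have too_big i j : (j <= i)%N -> beta ^- i != gamma * beta ^- j.
  move=> ji; rewrite lt_eqF// (le_lt_trans (betaV_le ji))//.
  by rewrite -[ltLHS]mul1r ltr_pM2r// invr_gt0 exprn_gt0.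
have x1 : o_ 1 = p_ 1.
  apply/eqP/negPn/negP => op.
  have n1 : (0 < 1 <= n)%N by rewrite n_gt0.
  have [[|[|m]] // _ pm] := o_in_p n1; first by move: op; rewrite pm eqxx.
  have [i i0 e] := pred_jump _ _ n1 pm op.
  by have := too_big _ _ i0; rewrite e eqxx.
split=> //; apply/eqP; rewrite eqn_leq n_gt0 andbT leqNgt; apply/negP => n2.
have n2' : (0 < 2 <= n)%N by [].
have o21 : o_ 2 != p_ 1.
  by apply/negP => /eqP; rewrite -x1 => /o_inj; rewrite n2 n_gt0 => /(_ isT isT).
have [[|[|m]] // _ pm] := o_in_p n2'; first by move: o21; rewrite -pm eqxx.
have [[|[|i]] // _ e] := pred_jump _ _ n2' pm o21.
  by have := no_jump 1; rewrite e eqxx.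
by have := @too_big i.+2 2 isT; rewrite e eqxx.
Qed.

(** For [n = 1] the total weights are [1 + 1 / beta] and [1 + 1 / (gamma - 1)]. As [o_ 2 = 0], the
    number [v = beta * o_ 1] is a positive integer below [beta], and [o_ 1 = beta - u] with
    [u = floor beta] gives the quadratic equation. *)
Lemma jump_comparison : gamma = beta + 1 /\ quadratic_parry beta.
Proof.
have [_ n1] := n_eq1; have := total_beta; rewrite n1 expr1.
rewrite total_eq weight_true//; last by move=> k; apply: orbit_gt0; exact: p_neq0.
have [B0 g10] : 0 < beta - 1 /\ 0 < gamma - 1 by rewrite !subr_gt0.
rewrite (_ : gamma / (gamma - 1) = 1 + (gamma - 1)^-1); last by field; rewrite gt_eqF.
rewrite (_ : (1 - beta^-1) / (beta - 1) = beta^-1); last by field; rewrite !gt_eqF.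
move=> /addrI /invr_inj gE; split; first by rewrite -gE subrK.
split=> //.
have := floor_fractional_part (beta * o_ 1); rewrite -orbit1S.
have := o_n1; rewrite n1 => ->; rewrite addr0.
have o1E : o_ 1 = beta - (Num.floor beta)%:~R by rewrite orbit1S /orbit1/= mulr1.
have o1pos : 0 < o_ 1 by apply/orbit_gt0/o_neq0.
have vpos : 0 < beta * o_ 1 by rewrite mulr_gt0.
have vlt : beta * o_ 1 < beta by rewrite -[ltRHS]mulr1 ltr_pM2l// o_lt1.
move=> vE; have u0 : 0 <= Num.floor beta by rewrite floor_ge0 ltW.
have v0 : 0 < Num.floor (beta * o_ 1) by rewrite -(ltr0z R) -vE.
have vu : Num.floor (beta * o_ 1) <= Num.floor beta by rewrite le_floor// ltW.
exists (absz (Num.floor beta)), (absz (Num.floor (beta * o_ 1))); split.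
  exact: absz_itv.
rewrite !natr_absz !ger0_norm ?(ltW v0)// -vE o1E.
by ring.
Qed.

End JumpComparison.

(** * Decomposition of jointly invariant measures *)

Section LebesgueDecomposition.
Context {R : realType}.
Local Notation X := (unit_interval R).
Local Notation lam := (@unit_lebesgue R).
Variable m : {finite_measure set X -> \bar R}.

Lemma beta_map_nonsingular (b : R) (A : set X) : 0 < b -> measurable A -> lam A = 0%E ->
  lam (beta_map b @^-1` A) = 0%E.
Proof.
move=> b0 mA A0.
have mTA : measurable (beta_map b @^-1` A).
  by apply: measurable_preimage => //; exact: measurable_beta_map.
apply: mass_eq0 => //; apply/eqP; rewrite eq_le mass_ge0 andbT.
rewrite -[X in mass _ X]setTI -segment01 mass_transfer//.
rewrite (eq0_mass A0) mulr0 add0r pmulr_rle0 ?invr_gt0// -(eq0_mass A0).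
by apply: le_mass => //; apply: measurableI => //; exact: measurable_segment.
Qed.

(** Exhaustion: the union of null sets whose [m]-masses approach the supremum attains it, so no null
    set outside the union can carry more mass. *)
Lemma maximal_null_set : exists B : set X, [/\ measurable B, lam B = 0%E &
  forall A, measurable A -> lam A = 0%E -> m (A `&` ~` B) = 0%E].
Proof.
pose S : set R := [set mass m B | B in [set B : set X | measurable B /\ lam B = 0%E]].
have supS : has_sup S.
  split; first by exists (mass m set0), set0 => //; split=> //; rewrite measure0.
  by exists (mass m setT) => _ [B [mB _] <-]; apply: le_mass.
have BP n : {B : set X | [/\ measurable B, lam B = 0%E & sup S - n.+1%:R^-1 < mass m B]}.
  apply: cid; have n0 : 0 < n.+1%:R^-1 :> R by [].
  by have [_ [B [mB B0] <-] h] := sup_adherent n0 supS; exists B.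
pose B := \bigcup_n projT1 (BP n).
have mB : measurable B by apply: bigcupT_measurable => n; case: (projT2 (BP n)).
have B0 : lam B = 0%E.
  by apply: measure_bigcup0 => n; case: (projT2 (BP n)).
have supB : sup S <= mass m B.
  apply/ler_addgt0Pr => e e0.
  have en : (Num.truncn e^-1).+1%:R^-1 < e by rewrite invf_plt ?posrE// truncnS_gt.
  case: (projT2 (BP (Num.truncn e^-1))) => mBn _ Bn.
  have : mass m (projT1 (BP (Num.truncn e^-1))) <= mass m B.
    by apply: le_mass => // x Bx; exists (Num.truncn e^-1).
  move=> le; apply: le_trans (lerD le (ltW en)).
  by rewrite -lerBlDr ltW.
exists B; split=> // A mA A0.
have mAB : measurable (A `&` ~` B) by apply: measurableI => //; exact: measurableC.
apply: mass_eq0 => //; apply/eqP; rewrite eq_le mass_ge0 andbT.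
have AB0 : lam (A `|` B) = 0%E.
  apply: mass_eq0; first exact: measurableU.
  have e := @massID _ _ _ lam (A `|` B) B (measurableU _ _ mA mB) mB.
  apply/eqP; rewrite eq_le mass_ge0 andbT e -(addr0 0) lerD//.
    by rewrite -(eq0_mass B0) le_mass//; apply: measurableI => //; exact: measurableU.
  rewrite -(eq0_mass A0) le_mass//; first by apply: measurableD => //; exact: measurableU.
  by move=> x [[]].
have : mass m (A `|` B) <= sup S.
  apply: ub_le_sup; first by case: supS.
  by exists (A `|` B) => //; split=> //; exact: measurableU.
have e := @massID _ _ _ m (A `|` B) B (measurableU _ _ mA mB) mB.
rewrite (_ : (A `|` B) `&` B = B) in e; last by apply/setIidPr; exact: subsetUr.
rewrite (_ : (A `|` B) `\` B = A `&` ~` B) in e; last first.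
  by rewrite setDUl setDv setU0.
by move: supB; rewrite e; lra.
Qed.

(* The singular part and the absolutely continuous part of an invariant measure are
   invariant, because the maps and their preimages preserve null sets. *)
Lemma invariant_decomposition : exists B (ms ma : {finite_measure set X -> \bar R}),
  [/\ measurable B, lam B = 0%E, ms (~` B) = 0%E,
    forall A, measurable A -> lam A = 0%E -> ma A = 0%E &
    (forall A, measurable A -> mass m A = mass ms A + mass ma A) /\
    forall b : R, 0 < b ->
      (forall A, measurable A -> mass m (beta_map b @^-1` A) = mass m A) ->
      (forall A, measurable A -> mass ms (beta_map b @^-1` A) = mass ms A) /\
      (forall A, measurable A -> mass ma (beta_map b @^-1` A) = mass ma A)].
Proof.
have [B [mB B0 Bmax]] := maximal_null_set.
pose ms : {finite_measure set X -> \bar R} := mrestr m mB.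
pose ma : {finite_measure set X -> \bar R} := mrestr m (measurableC mB).
have msE A : mass ms A = mass m (A `&` B) by [].
have maE A : mass ma A = mass m (A `&` ~` B) by [].
have sumE A : measurable A -> mass m A = mass ms A + mass ma A.
  by move=> mA; rewrite msE maE -setDE -massID.
exists B, ms, ma; split=> //.
  by rewrite /ms /= /mrestr setICl measure0.
split=> // b b0 mT.
have mpre A : measurable A -> measurable (beta_map b @^-1` A).
  by move=> mA; apply: measurable_preimage => //; exact: measurable_beta_map.
have msT A : measurable A -> mass ms (beta_map b @^-1` A) = mass ms A.
  move: A; apply: mass_preimage_ge_eq; first exact: measurable_beta_map.
  move=> A mA; have mAB : measurable (A `&` B) by exact: measurableI.
  have AB0 : lam (A `&` B) = 0%E.
    apply: mass_eq0 => //; apply/eqP; rewrite eq_le mass_ge0 andbT -(eq0_mass B0).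
    exact: le_mass.
  (* The preimage of the null set [A] meet [B] is null, so by maximality of [B] its part outside [B]
     has no mass. *)
  rewrite msE -mT// (@massID _ _ _ m _ B)//; last exact: mpre.
  rewrite [X in _ + X](_ : _ = 0) ?addr0.
    rewrite msE; apply: le_mass; [by apply: measurableI => //; exact: mpre..|].
    by move=> x [[]].
  apply: eq0_mass; rewrite setDE; apply: Bmax; first exact: mpre.
  exact: beta_map_nonsingular.
split=> // A mA; have := sumE _ mA; rewrite -mT// sumE ?msT//; last exact: mpre.
by move=> /addrI.
Qed.

End LebesgueDecomposition.

(** * The exceptional pairs of bases *)

Section Exceptional.
Context {R : realType}.
Local Notation X := (unit_interval R).
Local Notation lam := (@unit_lebesgue R).

(** With [t = v / b], the orbit of [1] is [1, t, 0, 0, ...] in base [b] and [1, t, t, ...] in base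
    [b + 1]. The weight of [[0, t)] is [1 / b] in both cases, by the geometric series of ratio
    [1 / (b + 1)]. *)
Lemma eq_parry_measure (b : R) (b1 : 1 < b) (c1 : 1 < b + 1) : quadratic_parry b ->
  forall A : set X, measurable A ->
    mass (parry_measure c1) A = mass (parry_measure b1) A.
Proof.
move=> [_ [u [v [/andP[v1 vu] bE]]]] A mA.
have b0 : 0 < b := lt_trans ltr01 b1.
have bn0 : b != 0 by rewrite gt_eqF.
have v1R : 1 <= v%:R :> R by rewrite ler1n.
have vuR : v%:R <= u%:R :> R by rewrite ler_nat.
pose t := v%:R / b; have tE : t = b - u%:R by rewrite /t; apply: (mulIf bn0); rewrite divfK//; lra.
have t0 : 0 < t by rewrite divr_gt0// (lt_le_trans ltr01).
have t1 : t < 1 by rewrite ltr_pdivrMr// mul1r; move: t0; rewrite tE; lra.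
have bt : b * t = v%:R by rewrite mulrC divfK.
have o1 : orbit1 b 1 = t.
  rewrite orbit1S /orbit1/= mulr1 (@fractional_part_eq _ u) -?pmulrn -?tE//.
  by rewrite (ltW t0).
have o2 n : orbit1 b n.+2 = 0.
  elim: n => [|n IHn]; last by rewrite orbit1S IHn mulr0 fractional_part0.
  by rewrite orbit1S o1 bt -[v%:R]add0r pmulrn fractional_partDz fractional_part0.
have p1 n : orbit1 (b + 1) n.+1 = t.
  elim: n => [|n IHn].
    rewrite orbit1S /orbit1/= mulr1 (@fractional_part_eq _ u.+1);
      rewrite -?pmulrn -natr1 opprD addrACA subrr addr0 -tE//.
    by rewrite (ltW t0).
  rewrite orbit1S IHn mulrDl bt mul1r addrC pmulrn fractional_partDz.
  by rewrite fractional_part_id// (ltW t0).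
rewrite !mass_parry//; set x := mass lam (A `&` segment 0 t).
have lA0 : 0 <= mass lam A by exact: mass_ge0.
have x0 : 0 <= x by exact: mass_ge0.
have term0 c : parry_term c A 0 = mass lam A.
  by rewrite /parry_term expr0 invr1 mul1r segment01 setIT.
pose w := mass lam A + b^-1 * x; have w0 : 0 <= w by rewrite addr_ge0// mulr_ge0// invr_ge0 ltW.
have seg0 : @segment R 0 0 = set0.
  by apply/seteqP; split=> // y /andP[h1 h2]; have := le_lt_trans h1 h2; rewrite ltxx.
transitivity w.
  (* With [N + 1] terms the error is of order [(b + 1) ^- N]; the factor [b + 1] in [K] absorbs this
     shift of the index. *)
  apply: (series_sum_eq c1 lA0 (fun n => parry_term_bound c1 n mA) (K := (b + 1) * w)).
  have c0 : b + 1 != 0 by rewrite gt_eqF// (lt_trans ltr01).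
  have sE N : \sum_(n < N.+1) parry_term (b + 1) A n =
      mass lam A + b^-1 * x - b^-1 * x * (b + 1) ^- N.
    elim: N => [|N IHN]; first by rewrite big_ord_recl big_ord0 term0 expr0; lra.
    rewrite big_ord_recr/= IHN /parry_term p1 -/x exprS invfM.
    by field; rewrite c0 bn0 expf_neq0.
  move=> [|N].
    rewrite big_ord0 subr0 ger0_norm// expr0 invr1 mulr1 ler_peMl//; lra.
  rewrite sE (_ : w - _ = b^-1 * x * (b + 1) ^- N); last by rewrite /w; ring.
  have q0 : 0 <= (b + 1) ^- N by rewrite invr_ge0 exprn_ge0// addr_ge0// ltW.
  have bx : 0 <= b^-1 * x by rewrite mulr_ge0// invr_ge0 ltW.
  rewrite ger0_norm; last exact: mulr_ge0.
  rewrite [leRHS](_ : _ = w * (b + 1) ^- N); last first.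
    by rewrite exprS invfM; field; rewrite c0 expf_neq0.
  by rewrite ler_wpM2r// lerDr.
apply/esym/(series_sum_eq b1 lA0 (fun n => parry_term_bound b1 n mA) (K := b * w)).
have sE N : \sum_(n < N.+2) parry_term b A n = w.
  elim: N => [|N IHN].
    by rewrite big_ord_recl term0 big_ord_recl big_ord0 addr0 /= /parry_term o1 expr1.
  by rewrite big_ord_recr/= IHN /parry_term o2 seg0 setI0 mass_set0 mulr0 addr0.
move=> [|[|N]].
- by rewrite big_ord0 subr0 ger0_norm// expr0 invr1 mulr1 ler_peMl// ltW.
- rewrite big_ord_recl big_ord0 term0 addr0 /w addrAC subrr add0r expr1 mulrAC mulfV// mul1r.
  by rewrite ger0_norm ?lerDr// mulr_ge0// invr_ge0 ltW.
- by rewrite sE subrr normr0 !mulr_ge0 ?invr_ge0 ?exprn_ge0// ltW.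
Qed.

End Exceptional.

(** * Classification of the jointly invariant measures *)

Section JointlyInvariant.
Context {R : realType}.
Local Notation X := (unit_interval R).
Local Notation lam := (@unit_lebesgue R).

Lemma common_ac_exceptional (b c : R) (m : {finite_measure set X -> \bar R}) :
  1 < b -> 1 < c -> b < c -> (orbit1 b 1 != 0) || (orbit1 c 1 != 0) ->
  (forall A, measurable A -> mass m (beta_map b @^-1` A) = mass m A) ->
  (forall A, measurable A -> mass m (beta_map c @^-1` A) = mass m A) ->
  (forall A, measurable A -> lam A = 0%E -> m A = 0%E) -> 0 < mass m setT ->
  c = b + 1 /\ quadratic_parry b.
Proof.
move=> b1 c1 bc nint mb mc mac m0.
have C0 : 0 < mass m setT / mass (parry_measure b1) setT.
  by rewrite divr_gt0// mass_parry_gt0.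
have D0 : 0 < mass m setT / mass (parry_measure c1) setT.
  by rewrite divr_gt0// mass_parry_gt0.
have CD A : measurable A -> mass m setT / mass (parry_measure b1) setT *
    mass (parry_measure b1) A = mass m setT / mass (parry_measure c1) setT *
    mass (parry_measure c1) A.
  by move=> mA; rewrite -!invariant_ac_parry.
exact: (jump_comparison b1 c1 bc (total_weight_eq bc C0 D0 CD) (jump_eq bc C0 D0 CD) nint).
Qed.

Lemma measurable_unit0 : measurable [set unit0 R].
Proof.
rewrite (_ : [set unit0 R] = @unit_val R @^-1` [set 0]).
  by apply: measurable_unit_val_preimage; exact: measurable_set1.
apply/seteqP; split=> x /= xE; first by rewrite xE.
exact: unit_val_inj.
Qed.

Lemma irrational_fractional_part_neq0 (b : R) : irrational b ->
  forall n, (0 < n)%N -> fractional_part (n%:R * b) != 0.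
Proof.
move=> birr n n0; apply/negP => /eqP h; apply: birr; apply/rationalP.
exists (Num.floor (n%:R * b)), n; have := floor_fractional_part (n%:R * b).
by rewrite h addr0 => <-; rewrite mulrC mulKf// pnatr_eq0 -lt0n.
Qed.

Lemma irrational_orbit1_neq0 (b : R) : irrational b -> orbit1 b 1 != 0.
Proof.
move=> /irrational_fractional_part_neq0 /(_ 1%N isT).
by rewrite orbit1S /orbit1/= mulr1 mul1r.
Qed.

Lemma common_denominator (a c : rat) : a + c != 1 -> exists (N : nat) (p q : int),
  [/\ (0 < N)%N, p + q != N%:Z &
    forall x : R, N%:R * (ratr a * x + ratr c) = p%:~R * x + q%:~R].
Proof.
move=> ac1; have da := denq_gt0 a; have dc := denq_gt0 c.
have da0 : (denq a)%:~R != 0 :> R by rewrite intr_eq0 gt_eqF.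
have dc0 : (denq c)%:~R != 0 :> R by rewrite intr_eq0 gt_eqF.
have dN : (absz (denq a * denq c))%:Z = denq a * denq c.
  by rewrite gez0_abs// ltW// mulr_gt0.
exists (absz (denq a * denq c)%R), (numq a * denq c), (numq c * denq a); split.
- by rewrite absz_gt0 mulf_neq0 ?gt_eqF.
- rewrite dN; apply: contra ac1 => /eqP h.
  have da' : (denq a)%:~R != 0 :> rat by rewrite intr_eq0 gt_eqF.
  have dc' : (denq c)%:~R != 0 :> rat by rewrite intr_eq0 gt_eqF.
  rewrite -[a]divq_num_den -[c]divq_num_den -subr_eq0.
  rewrite (_ : _ - 1 = ((numq a * denq c + numq c * denq a)%:~R - (denq a * denq c)%:~R)
     / ((denq a)%:~R * (denq c)%:~R)); last by rewrite intrD !intrM; field; rewrite da' dc'.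
  by rewrite h subrr mul0r.
- move=> x; rewrite [_%:R]pmulrn dN /ratr !intrM; field.
  by rewrite da0 dc0.
Qed.

(** [m] is the absolutely continuous part of [mu]; the singular part sits at [0] by
    [singular_dirac], so it is the point mass weighted by what [m] leaves. *)
Lemma jointly_invariant_decomposition (beta gamma : R) (a c : rat) (mu : probability X R) :
  1 < beta -> irrational beta -> gamma = ratr a * beta + ratr c -> 1 < gamma -> a + c != 1 ->
  invariant_measure (beta_map beta) mu -> invariant_measure (beta_map gamma) mu ->
  exists m : {finite_measure set X -> \bar R},
  [/\ forall A, measurable A -> mass m (beta_map beta @^-1` A) = mass m A,
    forall A, measurable A -> mass m (beta_map gamma @^-1` A) = mass m A,
    forall A, measurable A -> lam A = 0%E -> m A = 0%E,
    mass m setT <= 1 &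
    forall A, measurable A ->
      mu A = ((1 - mass m setT)%:E * dirac (unit0 R) A + m A)%E].
Proof.
move=> beta1 birr gE gamma1 ac1 mub mug.
have mb A : measurable A -> mass mu (beta_map beta @^-1` A) = mass mu A.
  by move=> mA; exact: (congr1 fine (mub _ mA)).
have mg A : measurable A -> mass mu (beta_map gamma @^-1` A) = mass mu A.
  by move=> mA; exact: (congr1 fine (mug _ mA)).
have [B [ms [ma [mB B0 msB maac [sumE inv]]]]] := invariant_decomposition mu.
have [msb mab] := inv _ (lt_trans ltr01 beta1) mb.
have [msg mag] := inv _ (lt_trans ltr01 gamma1) mg.
have [N [p [q [N0 pqN NE]]]] := common_denominator ac1.
have := NE beta; rewrite -gE => {}NE.
have ms0 := singular_dirac N0 NE (irrational_fractional_part_neq0 birr) pqN msb msg mB B0 msB.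
have tot : 1 = mass ms setT + mass ma setT.
  by rewrite -sumE// /mass /= probability_setT.
exists ma; split=> //; first by have := mass_ge0 ms setT; lra.
move=> A mA; rewrite diracE (massE ma mA) [LHS](massE mu mA) sumE// EFinD; congr (_ + _)%E.
rewrite -EFinM; congr EFin; rewrite (_ : 1 - mass ma setT = mass ms setT); last first.
  by rewrite {1}tot addrK.
have null C : measurable C -> C `<=` ~` [set unit0 R] -> mass ms C = 0.
  move=> mC C0; apply/eqP; rewrite eq_le mass_ge0 andbT -(eq0_mass ms0).
  by apply: le_mass => //; apply: measurableC; exact: measurable_unit0.
have [/set_mem A0|/negP A0] := boolP (unit0 R \in A).
  rewrite mulr1n mulr1 -[LHS]addr0 -(null (~` A)); [|exact: measurableC|].
    by rewrite massC// addrC subrK.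
  by move=> x Ax /= xE; apply: Ax; rewrite xE.
rewrite mulr0n mulr0; apply: null => // x Ax /= xE; apply: A0.
by rewrite inE -xE.
Qed.

Lemma dirac_invariant (b : R) A :
  dirac (unit0 R) (beta_map b @^-1` A) = dirac (unit0 R) A :> \bar R.
Proof.
have T0 : beta_map b (unit0 R) = unit0 R.
  apply: unit_val_inj; rewrite unit_val_beta_map.
  by rewrite [unit_val _](_ : _ = 0)// mulr0 fractional_part0.
rewrite !diracE; congr (_%:R%:E); congr nat_of_bool.
by apply/idP/idP; rewrite !inE /= T0.
Qed.

End JointlyInvariant.

Theorem theorem1p2 (R : realType) (beta : R) (a c : rat) (gamma : R) :
  1 < beta -> irrational beta ->
  gamma = ratr a * beta + ratr c -> 1 < gamma -> a + c != 1 ->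
  let b_minus := Num.min beta gamma in
  let b_plus := Num.max beta gamma in
  let jointly_invariant (mu : probability (unit_interval R) R) :=
    invariant_measure (beta_map beta) mu /\ invariant_measure (beta_map gamma) mu in
  let exceptional := b_plus = b_minus + 1 /\ quadratic_parry b_minus in
  (exceptional ->
    (forall mu : probability (unit_interval R) R,
      jointly_invariant mu <->
      exists t : R, 0 <= t <= 1 /\
        same_measure mu
          (fun A => (1 - t)%:E * dirac (unit0 R) A
                    + t%:E * renyi_parry b_minus A)%E) /\
    same_measure (renyi_parry b_minus) (renyi_parry b_plus)) /\
  (~ exceptional ->
    forall mu : probability (unit_interval R) R,
      jointly_invariant mu <-> same_measure mu (dirac (unit0 R))).
Proof.
move=> beta1 birr gE gamma1 ac1 bm bp jointly exceptional.
have bm1 : 1 < bm by rewrite lt_min beta1.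
have bp1 : 1 < bp by rewrite lt_max beta1.
(* Equality means [(1 - a) beta = c]: either [a = 1] and [c = 0], against [a + c <> 1], or
   [beta = c / (1 - a)] is rational. *)
have beta_neq : beta != gamma.
  apply/negP => /eqP bg; apply: birr; rewrite -bg in gE.
  have [aE|a1] := eqVneq a 1.
    move: gE; rewrite aE rmorph1 mul1r => /eqP.
    rewrite -[X in X == _]addr0 (inj_eq (addrI _)) eq_sym fmorph_eq0 => /eqP cE.
    by move: ac1; rewrite aE cE addr0 eqxx.
  have a1' : 1 - a != 0 by rewrite subr_eq0 eq_sym.
  exists (c / (1 - a)) => //; rewrite fmorph_div rmorphB rmorph1.
  apply: (canLR (mulfK _)); first by rewrite -[X in X - _](rmorph1 (@ratr R)) -rmorphB fmorph_eq0.
  by move: gE; lra.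
have jointlyE mu : jointly mu <->
    invariant_measure (beta_map bm) mu /\ invariant_measure (beta_map bp) mu.
  rewrite /jointly /bm /bp minEle maxEle; case: ifPn => _ //.
  by split=> -[].
have exc (m : {finite_measure set (unit_interval R) -> \bar R}) :
    (forall A, measurable A -> mass m (beta_map beta @^-1` A) = mass m A) ->
    (forall A, measurable A -> mass m (beta_map gamma @^-1` A) = mass m A) ->
    (forall A, measurable A -> @unit_lebesgue R A = 0%E -> m A = 0%E) ->
    0 < mass m setT -> exceptional.
  move=> mb mg mac m0; rewrite /exceptional /bm /bp.
  (* [gamma] may be an integer, for instance when [a = 0]; the nonzero first orbit point is the one
     of [beta], whichever base is the smaller. *)
  case: (ltgtP beta gamma) => [bg|gb|bg].
  - apply: (common_ac_exceptional beta1 gamma1 bg _ mb mg mac m0).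
    by rewrite (irrational_orbit1_neq0 birr).
  - apply: (common_ac_exceptional gamma1 beta1 gb _ mg mb mac m0).
    by rewrite (irrational_orbit1_neq0 birr) orbT.
  - by move: beta_neq; rewrite bg eqxx.
have decomp mu := @jointly_invariant_decomposition _ _ _ _ _ mu beta1 birr gE gamma1 ac1.
have dirac_inv b : invariant_measure (beta_map b) (dirac (unit0 R) : set _ -> \bar R).
  by move=> A mA; rewrite /pushforward dirac_invariant.
split=> [[bpE bmq]|nexc].
  have parryE A : measurable A -> renyi_parry bp A = renyi_parry bm A.
    move=> mA; rewrite (renyi_parryE bm1 mA) (renyi_parryE bp1 mA).
    move: (bp1); rewrite bpE => c1.
    by rewrite !(eq_parry_measure bm1 c1).
  split; last by move=> A mA; rewrite parryE.
  move=> mu; split=> [[mub mug]|[t [_ muE]]].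
    have [m [mb mg mac mT muE]] := decomp _ mub mug.
    (* The absolutely continuous part is its total mass times [renyi_parry bm], by
       [invariant_ac_parry]. *)
    exists (mass m setT); split; first by rewrite mass_ge0.
    move=> A mA; rewrite muE//; congr (_ + _)%E.
    have mbm B : measurable B -> mass m (beta_map bm @^-1` B) = mass m B.
      by move=> mB; rewrite /bm minEle; case: ifPn => _; [exact: mb|exact: mg].
    rewrite (renyi_parryE bm1 mA) (massE m mA) (invariant_ac_parry bm1 mbm mac mA) -EFinM.
    by congr EFin; rewrite mulrAC mulrA.
  apply/jointlyE.
  have [nbm _] := renyi_parry_spec bm1; have [nbp _] := renyi_parry_spec bp1.
  have inv b : invariant_measure (beta_map b) (renyi_parry bm) ->
      invariant_measure (beta_map b) mu.
    move=> nb A mA; have mTA : measurable (beta_map b @^-1` A).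
      by apply: measurable_preimage => //; exact: measurable_beta_map.
    rewrite /pushforward !muE// dirac_invariant; congr (_ + _ * _)%E.
    exact: nb.
  split; apply: inv => // A mA; have mTA : measurable (beta_map bp @^-1` A).
    by apply: measurable_preimage => //; exact: measurable_beta_map.
  by rewrite /pushforward -!parryE//; exact: nbp.
move=> mu; split=> [[mub mug] A mA|muE].
  have [m [mb mg mac mT ->//]] := decomp _ mub mug.
  have m0 : mass m setT = 0.
    apply/eqP; rewrite eq_le mass_ge0 andbT leNgt; apply/negP => m0.
    by apply: nexc; exact: (exc m).
  rewrite m0 subr0 mul1e (massE m mA) (_ : mass m A = 0) ?adde0//.
  by apply/eqP; rewrite eq_le mass_ge0 andbT -m0 le_mass.
have inv b : invariant_measure (beta_map b) mu.
  move=> A mA; rewrite /pushforward !muE ?dirac_invariant//.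
  by apply: measurable_preimage => //; exact: measurable_beta_map.
by split.
Qed.
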